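(* For every pair $(b,k)$ in the set $\{(6,6),(7,6),(8,6),(9,6),(10,6),(11,6),(12,6),(13,6),(14,6),(8,7),(9,7),(10,7),(11,7),(12,7),(13,7),(14,7),(10,8),(11,8),(12,8),(13,8),(14,8),(11,9),(12,9),(13,9),(14,9),(13,10),(14,10),(14,11)\}$ one has the strict inequality $$R_{(b,k)}<\left(\frac{1}{\log\frac{b}{k-3}}+\frac{b^{k-1}}{b^{\underline{k-1}}\log(b-k+2)}\right)^{-1},$$ where $b^{\underline{k-1}}=b(b-1)\cdots(b-k+2)$.
   Context: All logarithms are to base 2. For integers $b\ge k$ and $n\ge1$, a $(b,k)$-hash code of length $n$ is a subset $C\subseteq\{1,\dots,b\}^n$ such that for any $k$ distinct elements of $C$ there is a coordinate in which they are pairwise distinct; $A(b,k,n)$ is the largest size of such a code and $R_{(b,k)}=\limsup_{n\to\infty}\frac1n\log A(b,k,n)$. *)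

(* Defs.v *)
From HB Require Import structures.
From mathcomp Require Import all_boot all_order all_algebra.
From mathcomp Require Import all_classical all_reals all_analysis.
Set Implicit Arguments. Unset Strict Implicit. Unset Printing Implicit Defensive.
Import Order.TTheory GRing.Theory Num.Theory.

(* Alphabet {1,...,b} is represented by 'I_b; words of length n by n.-tuple 'I_b. *)

Definition hash_code (b k n : nat) (C : {set n.-tuple 'I_b}) : Prop :=
  forall S : {set n.-tuple 'I_b}, S \subset C -> #|S| = k ->
    exists i : 'I_n, {in S &, injective (fun x : n.-tuple 'I_b => tnth x i)}.

Definition A_hash (b k n : nat) : nat :=
  \max_(C : {set n.-tuple 'I_b} | `[< hash_code k C >]) #|C|.

Local Open Scope ring_scope.

Definition log2 {R : realType} (x : R) : R := ln x / ln 2.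

Definition R_hash {R : realType} (b k : nat) : \bar R :=
  limn_esup (fun n : nat => ((log2 (A_hash b k n)%:R) / n%:R)%:E).

Definition hash_bound {R : realType} (b k : nat) : R :=
  (1 / log2 (b%:R / (k - 3)%:R)
   + (b ^ (k - 1))%:R / ((b ^_ (k - 1))%:R * log2 (b - k + 2)%:R))^-1.

Definition hash_pairs : seq (nat * nat) :=
  [:: (6,6);(7,6);(8,6);(9,6);(10,6);(11,6);(12,6);(13,6);(14,6);
      (8,7);(9,7);(10,7);(11,7);(12,7);(13,7);(14,7);
      (10,8);(11,8);(12,8);(13,8);(14,8);
      (11,9);(12,9);(13,9);(14,9);(13,10);(14,10);(14,11)].

(* Main.v *)
Require Import Defs.
From mathcomp Require Import all_boot all_order all_algebra.
From mathcomp Require Import all_classical all_reals all_analysis.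
From mathcomp Require Import fintype finset ring lra zify.
Set Implicit Arguments. Unset Strict Implicit. Unset Printing Implicit Defensive.
Import Order.TTheory GRing.Theory Num.Theory.
Import numFieldNormedType.Exports.
Local Open Scope ring_scope.

(** Put m = k - 3. Hansel's lemma, applied to m + 1 codewords x, bounds ln #|C| by
    ln (b - m - 1) times the sum over the coordinates of the proportion of
    codewords y for which the symbols of x and y are pairwise distinct. The
    codewords x are drawn from a random box, which prescribes on the first l
    coordinates a window of m + 1 symbols; boxes still contain many codewords as
    long as (b / (m + 1))^l is much smaller than #|C|.

    In each coordinate this leads to the average, over random laws p of mean f, of
    the probability that m + 1 symbols of law p and one of law f are pairwise
    distinct. Completing a square in f - uniform replaces it by the maximum over
    single laws p of an affine combination of elementary symmetric polynomials,
    which is attained at a law uniform on its support. The result is that a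
    coordinate contributes at most U = b^_(m+2) / b^(m+2), and at most
    (2 / (b - 1)) U when it is one of the first l. Windows of size m + 1 (instead
    of m, which would give a contribution 0 but need more boxes) are what makes
    the final inequality strict. *)

(** * Preliminaries *)

Lemma big_setT (R : Type) (idx : R) (op : R -> R -> R) (I : finType) (F : I -> R) :
  \big[op/idx]_(i in [set: I]) F i = \big[op/idx]_i F i.
Proof. by apply: eq_bigl => i; rewrite inE. Qed.

Lemma big_ord_ifltn (R : Type) (idx : R) (op : Monoid.law idx) n l (x y : R) : (l <= n)%N ->
  \big[op/idx]_(i < n) (if (i < l)%N then x else y) =
  op (\big[op/idx]_(i < l) x) (\big[op/idx]_(i < n - l) y).
Proof.
move=> le_ln; rewrite -[in LHS](subnKC le_ln) big_split_ord /=.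
congr (op _ _); apply: eq_bigr => i _; first by rewrite ltn_ord.
by rewrite ltnNge leq_addr.
Qed.

Lemma card_family_prod (I J : finType) (F : I -> pred J) :
  #|family F| = (\prod_i #|F i|)%N.
Proof. by rewrite card_family foldrE big_map big_enum. Qed.

Lemma sum_card_family_le (I J K : finType) (Y : {set K}) (F : I -> pred J)
    (G : K -> I -> pred J) :
  (forall y i, {subset G y i <= F i}) ->
  {in Y &, forall y y', y != y' -> exists i, [disjoint G y i & G y' i]} ->
  (\sum_(y in Y) #|family (G y)| <= #|family F|)%N.
Proof.
move=> GF disj; under eq_bigr do rewrite -sum1_card.
rewrite (exchange_big_dep (mem (family F))) /= => [|y c _ /familyP cG]; last first.
  by apply/familyP => i; apply/GF/cG.
rewrite -[leqRHS]sum1_card; apply: leq_sum => c _; rewrite sum1_card.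
apply/card_le1_eqP => y y' /andP[/= yY /familyP cy] /andP[/= y'Y /familyP cy'].
apply/eqP; rewrite eq_sym; apply: contraT => /(disj _ _ yY y'Y)[i] /disjointFr/(_ (cy i)).
by rewrite cy'.
Qed.

Lemma ln_natr_ge0 (R : realType) n : 0 <= ln n%:R :> R.
Proof. by case: n => [|n]; [rewrite ln0|rewrite ln_ge0 // ler1n]. Qed.

Lemma ln_le_subr1 (R : realType) (x : R) : 0 < x -> ln x <= x - 1.
Proof.
by move=> x0; have := @le_ln1Dx R (x - 1); rewrite [1 + _]addrC subrK; apply; rewrite ltrBrDl subrr.
Qed.

Lemma ln_le_half (R : realType) (x : R) : 0 < x -> ln x <= x / 2.
Proof.
move=> x0; have := ln_le_subr1 (divr_gt0 x0 (ltr0Sn R 1)); have := ln_le_subr1 (ltr0Sn R 1).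
by rewrite ln_div ?posrE //; lra.
Qed.

Lemma ln_expn (R : realType) (a r : nat) : (0 < a)%N -> ln (a ^ r)%:R = r%:R * ln a%:R :> R.
Proof. by move=> a0; rewrite natrX lnXn ?ltr0n // mulr_natl. Qed.

Section NearInfinity.
Variable R : realType.
Local Open Scope classical_set_scope.

Lemma near_infty_affine_lt (a c d e M q : R) : 0 <= q < 1 -> c < M ->
  \forall n \near \oo, a * q ^+ n < 1 /\ n%:R * c + d < (1 - a * q ^+ n) * (n%:R * M - e).
Proof.
move=> /andP[q0 q1] cM.
have cvg_q : a * q ^+ n @[n --> \oo] --> a * 0.
  by apply: cvgMr; apply: cvg_expr; rewrite ger0_norm.
have cvg_inv : n%:R^-1 @[n --> \oo] --> (0 : R).
  apply/gtr0_cvgV0; last exact: cvgr_idn.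
  by near=> n; rewrite ltr0n; near: n; exact: nbhs_infty_gt.
have cvg_slack : (1 - a * q ^+ n) * (M - e * n%:R^-1) - d * n%:R^-1
    @[n --> \oo] --> (1 - a * 0) * (M - e * 0) - d * 0.
  apply: cvgB; last exact: cvgMr.
  by apply: cvgM; apply: cvgB; do ?[exact: cvg_cst|exact: cvgMr].
near=> n; split; first by near: n; apply: (cvgr_lt _ cvg_q); rewrite mulr0.
have n0 : 0 < n%:R :> R by rewrite ltr0n; near: n; exact: nbhs_infty_gt.
have : c < (1 - a * q ^+ n) * (M - e * n%:R^-1) - d * n%:R^-1.
  by near: n; apply: (cvgr_gt _ cvg_slack); rewrite !mulr0 !subr0 mul1r.
rewrite -(ltr_pM2l n0) -ltrBrDr; congr (_ < _); field.
by rewrite gt_eqF.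
Unshelve. all: by end_near. Qed.

Lemma limn_esup_le_near (u : nat -> \bar R) (M : \bar R) :
  (\forall n \near \oo, (u n <= M)%E) -> (limn_esup u <= M)%E.
Proof.
move=> [N _ uM]; apply: (@Order.POrderTheory.le_trans _ _ (ereal_sup (u @` [set n | (N <= n)%N]))).
  by apply: ereal_inf_lbound; exists [set n | (N <= n)%N] => //; exact: nbhs_infty_ge.
by apply: ge_ereal_sup => _ [n /= Nn <-]; exact: uM.
Qed.

End NearInfinity.

(** * Elementary symmetric polynomials *)

Section ElementarySymmetric.
Variables (R : comNzRingType) (T : finType).
Implicit Types (p q : T -> R) (S A : {set T}) (i j : T) (r : nat).

Definition elsym S p r : R :=
  \sum_(A : {set T} | (A \subset S) && (#|A| == r)) \prod_(l in A) p l.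

Definition elsym_gen S p : {poly R} := \prod_(l in S) (1 + p l *: 'X).

Lemma elsym_coef S p r : elsym S p r = (elsym_gen S p)`_r.
Proof.
apply/esym; rewrite /elsym_gen big_mkcond /=.
rewrite (eq_bigr (fun l => (if l \in S then p l *: 'X else 0) + 1)) => [|l _]; last first.
  by case: ifP; rewrite ?add0r // addrC.
rewrite bigA_distr coef_sum [RHS]big_mkcond; apply: eq_bigr => A _ /=.
rewrite (bigID (mem A)) /= [X in _ * X]big1 ?mulr1 => [|l /negbTE -> //].
have [AS|/subsetPn[l lA lS]] := boolP (A \subset S); last first.
  by rewrite (bigD1 l) //= lA (negbTE lS) mul0r coef0.
rewrite (eq_bigr (fun l => p l *: 'X)) => [|l lA]; last by rewrite lA (subsetP AS).
by rewrite scaler_prod prodr_const coefZ coefXn eq_sym; case: eqP; rewrite (mulr1, mulr0).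
Qed.

Lemma eq_elsym S p q r : {in S, p =1 q} -> elsym S p r = elsym S q r.
Proof.
move=> pq; apply: eq_bigr => A /andP[/subsetP AS _].
by apply: eq_bigr => l /AS /pq.
Qed.

Lemma elsym0 S p : elsym S p 0 = 1.
Proof.
rewrite elsym_coef -horner_coef0 horner_prod big1 // => l _.
by rewrite !hornerE.
Qed.

Lemma elsym_card S p r : (#|S| < r)%N -> elsym S p r = 0.
Proof.
move=> Sr; apply: big_pred0 => A; apply: contraTF Sr => /andP[AS /eqP <-].
by rewrite -leqNgt subset_leq_card.
Qed.

Lemma elsym_supp S S' p r : S \subset S' -> {in S' :\: S, forall l, p l = 0} ->
  elsym S' p r = elsym S p r.
Proof.
move=> SS' p0; rewrite /elsym (bigID (fun A => A \subset S)) /= [X in _ + X]big1 ?addr0.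
  apply: eq_bigl => A; rewrite andbAC [X in X && _]andb_idl // => AS.
  exact: subset_trans SS'.
move=> A /andP[/andP[/subsetP AS' _] /subsetPn[l lA lS]].
by rewrite (bigD1 l) //= p0 ?mul0r // inE lS AS'.
Qed.

Lemma elsym_const S c r : elsym S (fun=> c) r = 'C(#|S|, r)%:R * c ^+ r.
Proof.
rewrite /elsym (eq_bigr (fun=> c ^+ r)) => [|A /andP[_ /eqP <-]]; last exact: prodr_const.
by rewrite sumr_const mulr_natl -cards_draws cardsE.
Qed.

Lemma elsymZ S a p r : elsym S (fun l => a * p l) r = a ^+ r * elsym S p r.
Proof.
rewrite mulr_sumr; apply: eq_bigr => A /andP[_ /eqP <-].
by rewrite big_split prodr_const.
Qed.

Lemma elsym_gen_setD1 i S p : i \in S ->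
  elsym_gen S p = (1 + p i *: 'X) * elsym_gen (S :\ i) p.
Proof. by move=> iS; rewrite /elsym_gen (big_setD1 i). Qed.

Lemma elsym_setD1 i S p r : i \in S ->
  elsym S p r.+1 = elsym (S :\ i) p r.+1 + p i * elsym (S :\ i) p r.
Proof.
move=> iS; rewrite !elsym_coef (elsym_gen_setD1 _ iS) mulrDl mul1r.
by rewrite coefD -scalerAl coefZ coefXM.
Qed.

Lemma sum_elsym_setD1 S p r :
  \sum_(i in S) p i * elsym (S :\ i) p r = r.+1%:R * elsym S p r.+1.
Proof.
transitivity (\sum_(i in S)
    \sum_(A : {set T} | ((A \subset S) && (#|A| == r.+1)) && (i \in A)) \prod_(l in A) p l).
  apply: eq_bigr => i iS; apply: (addrI (elsym (S :\ i) p r.+1)).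
  rewrite -elsym_setD1 // {1}/elsym (bigID (fun A : {set T} => i \in A)) /= addrC.
  by congr (_ + _); apply: eq_bigl => A; rewrite subsetD1 andbAC.
rewrite (exchange_big_dep (fun A : {set T} => (A \subset S) && (#|A| == r.+1))) /=; last first.
  by move=> ? ? _ /andP[].
rewrite mulr_sumr; apply: eq_bigr => A /andP[AS /eqP rA].
rewrite (eq_bigl (mem A)); first by rewrite sumr_const rA mulr_natl.
by move=> i /=; rewrite AS rA eqxx /= andb_idl // => /(subsetP AS).
Qed.

Lemma elsym1 S p : elsym S p 1 = \sum_(i in S) p i.
Proof.
rewrite -[LHS]mul1r -(sum_elsym_setD1 S p 0).
by apply: eq_bigr => i _; rewrite elsym0 mulr1.
Qed.

Lemma sum_sqr_elsym S p :
  \sum_(i in S) p i ^+ 2 = (\sum_(i in S) p i) ^+ 2 - 2 * elsym S p 2.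
Proof.
rewrite -(sum_elsym_setD1 S p 1) expr2 mulr_suml -sumrB.
by apply: eq_bigr => i iS; rewrite -elsym1 (elsym_setD1 _ _ iS) elsym0 /=; ring.
Qed.

Lemma sum_injective_prod S p r :
  \sum_(s : {ffun 'I_r -> T} | injectiveb s && (codom s \subset S)) \prod_j p (s j) =
  r`!%:R * elsym S p r.
Proof.
rewrite /elsym (partition_big (fun s : {ffun 'I_r -> T} => [set s j | j : 'I_r])
   (fun A : {set T} => (A \subset S) && (#|A| == r))) /=; last first.
  move=> s /andP[/injectiveP si /subsetP sS]; rewrite card_imset // card_ord eqxx andbT.
  by apply/subsetP => _ /imsetP[j _ ->]; apply/sS/codom_f.
rewrite mulr_sumr; apply: eq_bigr => A /andP[AS /eqP Ar].
rewrite (eq_bigr (fun=> \prod_(l in A) p l)) => [|s /andP[/andP[/injectiveP si _] /eqP <-]].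
  rewrite sumr_const mulr_natl -(ffactnn r); congr (_ *+ _).
  have := card_inj_ffuns_on 'I_r (mem A); rewrite card_ord Ar => <-.
  apply: eq_card => s; rewrite unfold_in [RHS]inE -andbA [RHS]andbC.
  have [/injectiveP si /=|//] := boolP (injectiveb s).
  apply/andP/ffun_onP => [[_ /eqP <-] j|sA]; first exact: imset_f.
  split; first by apply/subsetP => _ /codomP[j ->]; exact: (subsetP AS).
  rewrite eqEcard card_imset // card_ord Ar leqnn andbT.
  by apply/subsetP => _ /imsetP[j _ ->].
by rewrite big_imset => [|? ? _ _ /si].
Qed.

End ElementarySymmetric.

Lemma elsym_ge0 (R : realDomainType) (T : finType) (S : {set T}) (p : T -> R) r :
  {in S, forall l, 0 <= p l} -> 0 <= elsym S p r.
Proof.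
move=> p0; apply: sumr_ge0 => A /andP[/subsetP AS _].
by apply: prodr_ge0 => l /AS /p0.
Qed.

(** * Maxima over the simplex of laws *)

Section Birthday.
Variable R : realFieldType.
Implicit Types n r : nat.

Definition birthday n r : R := \prod_(j < r) (1 - j%:R / n%:R).

Lemma birthday0 n : birthday n 0 = 1.
Proof. exact: big_ord0. Qed.

Lemma birthdayS n r : birthday n r.+1 = birthday n r * (1 - r%:R / n%:R).
Proof. exact: big_ord_recr. Qed.

Lemma birthdayE n r : (0 < n)%N -> birthday n r = (n ^_ r)%:R / (n ^ r)%:R.
Proof.
move=> n0; have nR : n%:R != 0 :> R by rewrite pnatr_eq0 -lt0n.
elim: r => [|r IHr]; first by rewrite birthday0 ffactn0 expn0 divr1.
rewrite birthdayS IHr ffactnSr expnSr !natrM.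
have [rn|nr] := leqP r n; last by rewrite ffact_small // !mul0r.
by rewrite natrB // natrX; field; rewrite nR expf_neq0.
Qed.

Lemma birthday_ge0 n r : (0 < n)%N -> 0 <= birthday n r.
Proof. by move=> n0; rewrite birthdayE. Qed.

Lemma birthday_gt0 n r : (0 < n)%N -> (r <= n)%N -> 0 < birthday n r.
Proof. by move=> n0 rn; rewrite birthdayE // divr_gt0 // ltr0n ?ffact_gt0 ?expn_gt0 ?n0. Qed.

Lemma birthday_small n r : (0 < n < r)%N -> birthday n r = 0.
Proof. by move=> /andP[n0 nr]; rewrite birthdayE // ffact_small // mul0r. Qed.

Lemma ler_birthday n n' r : (0 < n <= n')%N -> birthday n r <= birthday n' r.
Proof.
move=> /andP[n0 nn']; have [rn|nr] := leqP r n; last first.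
  by rewrite birthday_small ?n0 // birthday_ge0 // (leq_trans n0).
apply: ler_prod => j _; have jn : (j < n)%N := leq_trans (ltn_ord j) rn.
rewrite subr_ge0 ler_pdivrMr ?ltr0n // mul1r ler_nat ltnW //= lerD2l lerN2.
by rewrite ler_wpM2l // lef_pV2 ?posrE ?ltr0n ?ler_nat // (leq_trans n0).
Qed.

Lemma birthday_le1 n r : (0 < n)%N -> birthday n r <= 1.
Proof.
move=> n0; rewrite birthdayE // ler_pdivrMr ?ltr0n ?expn_gt0 ?n0 // mul1r ler_nat.
rewrite ffact_prod -[X in (_ ^ X)%N]card_ord -prod_nat_const.
by apply: leq_prod => j _; exact: leq_subr.
Qed.

Lemma birthday_ge n r : (0 < n)%N -> 1 - r%:R ^+ 2 / n%:R <= birthday n r.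
Proof.
move=> n0; have nR : 0 < n%:R :> R by rewrite ltr0n.
elim: r => [|r IHr]; first by rewrite birthday0 expr0n mul0r subr0.
have : birthday n r * (r%:R / n%:R) <= 1 * (r%:R / n%:R).
  by rewrite ler_wpM2r ?birthday_le1 // divr_ge0.
rewrite birthdayS mulrBr mulr1 mul1r => /(lerB IHr); apply: le_trans.
rewrite -addrA -opprD -mulrDl lerD2l lerN2 ler_pM2r ?invr_gt0 // -natr1.
by have := ler0n R r; nra.
Qed.

Lemma elsym_uniform (T : finType) (S : {set T}) r : (0 < #|S|)%N ->
  elsym S (fun=> #|S|%:R^-1) r = birthday #|S| r / r`!%:R.
Proof.
move=> S0; rewrite elsym_const birthdayE // -bin_ffact natrM natrX exprVn mulrAC.
by rewrite mulfK // pnatr_eq0 -lt0n fact_gt0.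
Qed.

End Birthday.

Section Laws.
Variables (R : realFieldType) (T : finType).
Implicit Types (p q : T -> R) (S : {set T}) (i j : T) (x y : R) (c : seq (R * nat)).

Definition law S p : Prop :=
  [/\ forall l, 0 <= p l, forall l, l \notin S -> p l = 0 & \sum_l p l = 1].

Definition supp p : {set T} := [set l | p l != 0].

Definition elsym_comb c p : R := \sum_(x <- c) x.1 * elsym [set: T] p x.2.

Definition elsym_comb_uniform c n : R := \sum_(x <- c) x.1 * (birthday R n x.2 / x.2`!%:R).

Lemma elsym_law S p r : law S p -> elsym [set: T] p r = elsym S p r.
Proof.
move=> [_ pS _]; apply: elsym_supp; first exact: subsetT.
by move=> l; rewrite !inE andbT => /pS.
Qed.

Lemma elsym_comb_affine c p i j : i != j -> exists a b : R, forall q,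
  {in ~: [set i; j], q =1 p} -> q i + q j = p i + p j ->
  elsym_comb c q = a + b * (q i * q j).
Proof.
move=> ij; pose P := elsym_gen ([set: T] :\ i :\ j) p.
pose L (Q : {poly R}) := \sum_(x <- c) x.1 * Q`_x.2.
have LD Q Q' : L (Q + Q') = L Q + L Q'.
  by rewrite -big_split; apply: eq_bigr => x _; rewrite coefD mulrDr.
have LZ a Q : L (a *: Q) = a * L Q.
  by rewrite mulr_sumr; apply: eq_bigr => x _; rewrite coefZ mulrCA.
exists (L (P + (p i + p j) *: ('X * P))), (L ('X * ('X * P))) => q qp qij.
transitivity (L (elsym_gen [set: T] q)).
  by apply: eq_bigr => x _; rewrite elsym_coef.
rewrite (elsym_gen_setD1 _ (in_setT i)) (@elsym_gen_setD1 _ _ j) ?inE 1?eq_sym ?ij //.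
have -> : elsym_gen ([set: T] :\ i :\ j) q = P.
  apply: eq_bigr => l; rewrite !inE andbT => /andP[lj li].
  by rewrite qp // !inE negb_or li.
rewrite [L _ * _]mulrC -LZ -LD -qij; congr L; rewrite -!mul_polyC polyCD polyCM; ring.
Qed.

Lemma law_redistribute S p i j x y : i != j -> i \in S -> j \in S ->
  0 <= x -> 0 <= y -> x + y = p i + p j -> law S p ->
  law S [eta p with i |-> x, j |-> y].
Proof.
move=> ij iS jS x0 y0 xy [p0 pS p1]; split => /= [l|l|].
- by case: ifP => // _; case: ifP.
- move=> lS; rewrite !ifN ?pS //; first by apply: contraNneq lS => ->.
  by apply: contraNneq lS => ->.
- have ji : j != i by rewrite eq_sym.
  rewrite (bigD1 i) // (bigD1 j) //= !eqxx (negbTE ji) -p1 [in RHS](bigD1 i) //=.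
  rewrite [in RHS](bigD1 j) //= !addrA xy; congr (_ + _); apply: eq_bigr => l.
  by move=> /andP[/negbTE -> /negbTE ->].
Qed.

Lemma supp_redistribute p i j : p i != 0 -> p j != 0 -> i != j ->
  supp [eta p with i |-> p i + p j, j |-> 0] \proper supp p.
Proof.
move=> pi pj ij; apply/properP; split; last first.
  by exists j; rewrite !inE //= [j == i]eq_sym (negbTE ij) eqxx negbK.
apply/subsetP => l; rewrite !inE /=; case: (eqVneq l i) => [->|_] //.
by case: ifP; rewrite ?eqxx.
Qed.

(* With [p i + p j] fixed the combination is affine in [p i * p j]. If the
   slope is positive, averaging [p i] and [p j] would increase it. *)
Lemma maximal_law_shrink c S p i j : law S p ->
  (forall q, law S q -> elsym_comb c q <= elsym_comb c p) ->
  p i != 0 -> p j != 0 -> p i != p j ->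
  exists q, [/\ law S q, supp q \proper supp p & elsym_comb c p <= elsym_comb c q].
Proof.
move=> pS pmax pi pj pij; have [p0 pS0 _] := pS.
have ij : i != j by apply: contraNneq pij => ->.
have inS l : p l != 0 -> l \in S by apply: contraNT => /pS0 ->.
have [a [b ab]] := elsym_comb_affine c p ij.
have combE x y : x + y = p i + p j ->
    elsym_comb c [eta p with i |-> x, j |-> y] = a + b * (x * y).
  move=> xy; rewrite ab /= ?eqxx 1?[j == i]eq_sym ?(negbTE ij) // => l.
  by rewrite !inE negb_or => /andP[/negbTE -> /negbTE ->].
have pE : elsym_comb c p = a + b * (p i * p j) by exact: ab.
have redistribute x y := @law_redistribute S p i j x y ij (inS _ pi) (inS _ pj).
have [b0|b0] := leP b 0; last first.
  have /pmax : law S [eta p with i |-> (p i + p j) / 2, j |-> (p i + p j) / 2].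
    by apply: redistribute => //; rewrite ?divr_ge0 ?addr_ge0 //; field.
  rewrite combE ?pE; last by field.
  rewrite lerD2l ler_pM2l //.
  have : 0 < (p i - p j) ^+ 2 by rewrite lt0r sqr_ge0 sqrf_eq0 subr_eq0 pij.
  nra.
exists [eta p with i |-> p i + p j, j |-> 0]; split.
- by apply: redistribute; rewrite ?addr0 ?addr_ge0.
- exact: supp_redistribute.
- rewrite combE ?addr0 // pE mulr0 mulr0 addr0 gerDl.
  by rewrite mulr_le0_ge0 ?mulr_ge0.
Qed.

Lemma elsym_comb_const_supp c S p : law S p -> {in supp p &, forall i j, p i = p j} ->
  exists2 n, (0 < n <= #|S|)%N & elsym_comb c p = elsym_comb_uniform c n.
Proof.
move=> [p0 pS p1] pconst.
have pD : law (supp p) p by split=> // l; rewrite inE negbK => /eqP.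
have [i iD] : exists i, i \in supp p.
  apply/set0Pn; apply: contra_eq_neq p1 => D0; rewrite big1 1?eq_sym ?oner_neq0 //.
  by move=> l _; case: pD => _ -> //; rewrite D0 inE.
have D0 : (0 < #|supp p|)%N by apply/card_gt0P; exists i.
have pi : p i = #|supp p|%:R^-1.
  apply: (@mulfI _ #|supp p|%:R); first by rewrite pnatr_eq0 -lt0n.
  rewrite mulfV ?pnatr_eq0 -?lt0n //; apply: etrans p1.
  rewrite [RHS](bigID (mem (supp p))) /= [X in _ = _ + X]big1 ?addr0; last by case: pD.
  by rewrite mulr_natl -sumr_const; apply: eq_bigr => l lD; rewrite (pconst i l).
exists #|supp p|.
  rewrite D0 subset_leq_card //; apply/subsetP => l.
  by rewrite inE; apply: contraNT => /pS ->.
apply: eq_bigr => x _; rewrite (elsym_law _ pD) -elsym_uniform //; congr (_ * _).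
by apply: eq_elsym => l lD; rewrite (pconst l i).
Qed.

Lemma maximal_law_le c S K :
  (forall n, (0 < n <= #|S|)%N -> elsym_comb_uniform c n <= K) ->
  forall p, law S p -> (forall q, law S q -> elsym_comb c q <= elsym_comb c p) ->
  elsym_comb c p <= K.
Proof.
move=> le_K p; have [n] := ubnP #|supp p|; elim: n p => // n IHn p pn pS pmax.
have [/forall_inP pconst|] := boolP [forall i in supp p, forall j in supp p, p i == p j].
  have [||k kS ->] := @elsym_comb_const_supp c S p; [by []| |exact: le_K].
  by move=> i j /pconst/forall_inP ij /ij/eqP.
case/forall_inPn => i iD /forall_inPn[j jD pij]; rewrite !inE in iD jD.
have [q [qS qp pq]] := maximal_law_shrink pS pmax iD jD pij.
apply: (le_trans pq); apply: IHn (leq_trans (proper_card qp) pn) qS _ => q' /pmax q'p.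
exact: le_trans pq.
Qed.

End Laws.

Section SimplexMaximum.
Variables (R : realType) (T : finType).
Implicit Types (p q : T -> R) (S : {set T}) (l : T) (c : seq (R * nat)).
Import ArrowAsProduct.

Lemma continuous_coord l : continuous (fun p : T -> R => p l).
Proof. exact: (@proj_continuous T (fun=> R : topologicalType) l). Qed.

Lemma continuous_elsym S r : continuous (fun p : T -> R => elsym S p r).
Proof.
apply: continuous_big => [|A _]; first exact: add_continuous.
apply: continuous_big => [|l _]; first exact: mul_continuous.
exact: continuous_coord.
Qed.

Lemma continuous_elsym_comb c : continuous (elsym_comb c : (T -> R) -> R).
Proof.
apply: continuous_big => [|x _ p]; first exact: add_continuous.
by apply: cvgM (@continuous_elsym _ _ p); exact: cvg_cst.
Qed.

Lemma compact_law S : compact [set p : T -> R | law S p]%classic.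
Proof.
pose box l : set R := if l \in S then `[0, 1]%classic else [set 0]%classic.
have -> : [set p : T -> R | law S p]%classic =
    ([set p : T -> R | forall l, box l (p l)] `&` [set p | \sum_l p l = 1])%classic.
  apply/seteqP; split => [p [p0 pS p1]|p [pb p1]].
    split => // l; rewrite /box; case: ifP => [_|/negbT/pS -> //] /=.
    by rewrite in_itv /= p0 -p1 (bigD1 l) //= lerDl sumr_ge0.
  split => // [l|l lS]; have := pb l; rewrite /box; last by rewrite (negbTE lS).
  by case: ifP => _ /=; [rewrite in_itv /= => /andP[]|move=> ->].
apply: compact_closedI.
  apply: (@tychonoff T (fun=> R : topologicalType)) => l; rewrite /box.
  by case: ifP => _; [exact: segment_compact|exact: compact_set1].
have cs : continuous (fun p : T -> R => \sum_l p l).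
  by apply: continuous_big => [|l _]; [exact: add_continuous|exact: continuous_coord].
by have /continuous_closedP/(_ _ (@closed_eq _ (1 : R))) := cs.
Qed.

Lemma elsym_comb_le c S K :
  (forall n, (0 < n <= #|S|)%N -> elsym_comb_uniform c n <= K) ->
  forall p, law S p -> elsym_comb c p <= K.
Proof.
move=> le_K p pS.
have [||q] := compact_EVT_max _ (@compact_law S) (f := elsym_comb c); first by exists p.
  exact/continuous_subspaceT/continuous_elsym_comb.
rewrite in_setE /= => qS qmax.
have {}qmax p' : law S p' -> elsym_comb c p' <= elsym_comb c q.
  by move=> p'S; apply: qmax; rewrite in_setE.
by apply: le_trans (maximal_law_le le_K qS qmax); exact: qmax.
Qed.

Lemma elsym_law_le S p r : law S p -> elsym S p r <= birthday R #|S| r / r`!%:R.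
Proof.
move=> pS; rewrite -(elsym_law r pS).
have := @elsym_comb_le [:: (1, r)] S (birthday R #|S| r / r`!%:R).
rewrite /elsym_comb => /(_ _ _ pS); rewrite big_seq1 mul1r; apply => n nS.
by rewrite /elsym_comb_uniform big_seq1 mul1r ler_pM2r ?ler_birthday // invr_gt0 ltr0n fact_gt0.
Qed.

(* Maclaurin's inequality *)
Lemma elsym_sublaw_le S p r : {in S, forall l, 0 <= p l} -> \sum_(l in S) p l <= 1 ->
  (0 < #|S|)%N -> elsym S p r <= birthday R #|S| r / r`!%:R.
Proof.
case: r => [|r] p0 p1 S0; first by rewrite elsym0 birthday0 divr1.
have : 0 <= \sum_(l in S) p l by exact: sumr_ge0.
rewrite le_eqVlt => /predU1P[/esym/eqP|s0].
  rewrite psumr_eq0 // => /allP pE; rewrite (@eq_elsym _ _ _ p (fun=> 0)).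
    by rewrite elsym_const expr0n mulr0 divr_ge0 ?birthday_ge0.
  by move=> l lS; apply/eqP; have := pE l; rewrite mem_index_enum lS; apply.
set s := \sum_(l in S) _ in p1 s0.
pose q l := if l \in S then p l / s else 0.
have qS : law S q.
  split => [l|l /negbTE lS|]; rewrite /q; last by rewrite -big_mkcond -mulr_suml mulfV ?gt_eqF.
    by case: ifP => // lS; rewrite divr_ge0 ?p0 // ltW.
  by rewrite lS.
have qE l : l \in S -> p l = s * q l by move=> lS; rewrite /q lS mulrC divfK // gt_eqF.
rewrite (eq_elsym _ qE) elsymZ; apply: le_trans (elsym_law_le _ qS).
apply: ler_piMl; last by rewrite exprn_ile1 // ltW.
by apply: elsym_ge0 => l _; case: qS.
Qed.

End SimplexMaximum.

(** * Averages over laws with a given mean *)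

Section Centering.
Variables (R : realFieldType) (T : finType).
Implicit Types x y : T -> R.
Hypothesis T_gt0 : (0 < #|T|)%N.
Let T_neq0 : #|T|%:R != 0 :> R. Proof. by rewrite pnatr_eq0 -lt0n. Qed.

Definition centered x j : R := x j - (\sum_l x l) / #|T|%:R.

Lemma sum_centered x : \sum_j centered x j = 0.
Proof. by rewrite sumrB sumr_const -[X in _ - X]mulr_natr divfK ?subrr. Qed.

Definition cov x y : R := \sum_j centered x j * centered y j.

Lemma cov_mulr x y : cov x y = \sum_j centered x j * y j.
Proof.
rewrite /cov; under eq_bigr do rewrite mulrBr.
by rewrite sumrB -mulr_suml sum_centered mul0r subr0.
Qed.

Lemma covE x y :
  cov x y = \sum_j x j * y j - (\sum_j x j) * (\sum_j y j) / #|T|%:R.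
Proof.
rewrite cov_mulr; under eq_bigr do rewrite mulrBl.
by rewrite sumrB -mulr_sumr mulrAC.
Qed.

Lemma sum_mul_pairs x y :
  \sum_i \sum_j (x i - x j) * (y i - y j) = 2 * #|T|%:R * cov x y.
Proof.
transitivity (\sum_i (#|T|%:R * (x i * y i) - x i * (\sum_j y j) - y i * (\sum_j x j)
   + \sum_j x j * y j)).
  apply: eq_bigr => i _; rewrite mulr_natl -sumr_const !mulr_sumr -!sumrB -big_split /=.
  by apply: eq_bigr => j _; ring.
rewrite big_split !sumrB /= -!mulr_suml -mulr_sumr sumr_const -mulr_natl covE.
by field.
Qed.

End Centering.

Section Share.
Variables (R : realFieldType) (T : finType) (m : nat).
Implicit Types (p f : T -> R) (S : {set T}) (i j : T) (k E K : R).
Local Notation b := (#|T|%:R : R).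
Local Notation e r p := (elsym [set: T] p r).
Hypothesis T_gt0 : (0 < #|T|)%N.
Let b_neq0 : b != 0. Proof. by rewrite pnatr_eq0 -lt0n. Qed.

(* Up to the factor (m+1)!, the probabilities that m+1 independent symbols of
   law p are pairwise distinct and, respectively, avoid a further symbol of law
   f, or include the symbol j. *)
Definition distinct p f : R := \sum_j f j * elsym ([set: T] :\ j) p m.+1.

Definition share p j : R := p j * elsym ([set: T] :\ j) p m.

Lemma shareE p j : share p j = e m.+1 p - elsym ([set: T] :\ j) p m.+1.
Proof. by rewrite /share (@elsym_setD1 _ _ j) ?inE // addrAC subrr add0r. Qed.

Lemma sum_share p : \sum_j share p j = m.+1%:R * e m.+1 p.
Proof. by rewrite -sum_elsym_setD1 big_setT. Qed.

Lemma sum_mul_share p : \sum_j p j = 1 ->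
  \sum_j p j * share p j = e m.+1 p - m.+2%:R * e m.+2 p.
Proof.
move=> p1; rewrite -sum_elsym_setD1 big_setT -[e m.+1 p]mul1r -p1 mulr_suml -sumrB.
by apply: eq_bigr => j _; rewrite shareE mulrBr.
Qed.

Lemma cov_share p : \sum_j p j = 1 ->
  cov p (share p) = (1 - m.+1%:R / b) * e m.+1 p - m.+2%:R * e m.+2 p.
Proof. by move=> p1; rewrite covE // sum_mul_share // sum_share p1; field. Qed.

Lemma cov_law p : \sum_j p j = 1 -> cov p p = 1 - b^-1 - 2 * e 2 p.
Proof.
move=> p1; have := sum_sqr_elsym [set: T] p; rewrite !big_setT p1 expr1n => p2.
by rewrite covE //; under eq_bigr do rewrite -expr2; rewrite p2 p1; field.
Qed.

Lemma share_sub p i j : i != j ->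
  share p i - share p j = (p i - p j) * elsym ([set: T] :\ i :\ j) p m.
Proof.
move=> ij; have Dij : [set: T] :\ j :\ i = [set: T] :\ i :\ j by rewrite !setDDl setUC.
rewrite /share; case: m => [|r]; first by rewrite !elsym0; ring.
rewrite (@elsym_setD1 _ _ j ([set: T] :\ i)) ?inE 1?eq_sym ?ij //.
by rewrite (@elsym_setD1 _ _ i ([set: T] :\ j)) ?inE ?ij // Dij; ring.
Qed.

(* Both sides are sums over pairs of symbols, which compare termwise. *)
Lemma share_var_le p E : (forall l, 0 <= p l) -> \sum_l p l = 1 ->
  (forall i j, i != j -> elsym ([set: T] :\ i :\ j) p m <= E) ->
  cov (share p) (share p) <= E * cov p (share p).
Proof.
move=> p0 p1 pE; have b2_gt0 : 0 < 2 * b by rewrite mulr_gt0 // ltr0n.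
rewrite -(ler_pM2l b2_gt0) mulrCA -!sum_mul_pairs //.
rewrite mulr_sumr; apply: ler_sum => i _; rewrite mulr_sumr; apply: ler_sum => j _.
have [->|ij] := eqVneq i j; first by rewrite !subrr mul0r mulr0.
rewrite share_sub //; set d := elsym _ _ _.
have d0 : 0 <= d by apply: elsym_ge0.
rewrite -subr_ge0; have -> : E * ((p i - p j) * ((p i - p j) * d)) -
  (p i - p j) * d * ((p i - p j) * d) = (p i - p j) ^+ 2 * (d * (E - d)) by ring.
by rewrite mulr_ge0 ?sqr_ge0 // mulr_ge0 // subr_ge0 pE.
Qed.

Lemma share_supp p S j : law S p -> #|S| = m.+1 ->
  share p j = if j \in S then e m.+1 p else 0.
Proof.
move=> [_ pS _] Sm; case: ifP => jS; last by rewrite /share pS ?jS // mul0r.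
rewrite shareE [elsym (_ :\ j) _ _](@elsym_supp _ _ (S :\ j)) ?setSD ?subsetT //.
  rewrite [elsym (S :\ j) _ _]elsym_card ?subr0 //.
  by have := cardsD1 j S; rewrite jS Sm => -[->].
by move=> l; rewrite !inE; case: eqP => //= _; rewrite andbT => /pS.
Qed.

Lemma share_var_supp p S : law S p -> #|S| = m.+1 ->
  cov (share p) (share p) = m.+1%:R * e m.+1 p * cov p (share p).
Proof.
move=> pS Sm; have sum2 : \sum_j share p j * share p j = m.+1%:R * e m.+1 p ^+ 2.
  rewrite mulr_natl -[X in _ *+ X]Sm -sumr_const [RHS]big_mkcond /=; apply: eq_bigr => j _.
  by rewrite (share_supp _ pS) //; case: ifP => _; rewrite ?mul0r ?expr2.
have [_ _ p1] := pS; rewrite cov_share // covE // sum2 sum_share (elsym_law m.+2 pS).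
by rewrite [elsym S p m.+2]elsym_card ?Sm //; field.
Qed.

Lemma distinctE p f : \sum_j f j = 1 ->
  distinct p f = (1 - m.+1%:R / b) * e m.+1 p - cov f (share p).
Proof.
move=> f1; transitivity ((\sum_j f j) * e m.+1 p - \sum_j f j * share p j).
  by rewrite mulr_suml -sumrB; apply: eq_bigr => j _; rewrite shareE; ring.
by rewrite covE // sum_share f1; field.
Qed.

Definition surrogate k p : R := (1 - m.+1%:R / b) * e m.+1 p
  + (k * cov p p - 2 * cov p (share p) + cov (share p) (share p) / k) / 4.

(* Completing the square in [centered f]. *)
Lemma distinct_le_surrogate k p f : 0 < k -> \sum_j p j = 1 -> \sum_j f j = 1 ->
  distinct p f <= surrogate k p + k * (cov f f - cov f p).
Proof.
move=> k0 p1 f1; have k_neq0 : k != 0 by rewrite gt_eqF.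
pose sqr j := (k * centered p j - centered (share p) j - 2 * k * centered f j) ^+ 2.
have sqr_sum : \sum_j sqr j / (4 * k) = surrogate k p + k * (cov f f - cov f p) - distinct p f.
  transitivity ((k * cov p p - 2 * cov p (share p) + cov (share p) (share p) / k) / 4
     + k * (cov f f - cov f p) + cov f (share p)).
    rewrite /cov !(mulr_suml, mulr_sumr, =^~ sumrB, =^~ big_split) /=.
    by apply: eq_bigr => j _; rewrite /sqr; field.
  by rewrite distinctE // /surrogate; ring.
rewrite -subr_ge0 -sqr_sum; apply: sumr_ge0 => j _.
by rewrite divr_ge0 ?sqr_ge0 // mulr_ge0 // ltW.
Qed.

(* Averaging [cov f P_t] over t gives [cov f f]. *)
Lemma distinct_mixture_le (I : finType) (w : I -> R) (P : I -> T -> R) f k K :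
  0 < k -> (forall t, 0 <= w t) -> \sum_t w t = 1 ->
  (forall j, \sum_t w t * P t j = f j) ->
  (forall t, 0 < w t -> \sum_j P t j = 1 /\ surrogate k (P t) <= K) ->
  \sum_t w t * distinct (P t) f <= K.
Proof.
move=> k0 w0 w1 fE PK.
have w_pos t : w t = 0 \/ 0 < w t.
  by have := w0 t; rewrite le_eqVlt => /predU1P[<-|]; [left|right].
have f1 : \sum_j f j = 1.
  rewrite -w1; under eq_bigr do rewrite -fE.
  rewrite exchange_big /=; apply: eq_bigr => t _; rewrite -mulr_sumr.
  by have [->|/PK[-> _]] := w_pos t; rewrite ?mul0r ?mulr1.
have covP : \sum_t w t * cov f (P t) = cov f f.
  under eq_bigr do rewrite cov_mulr // mulr_sumr.
  rewrite exchange_big cov_mulr //=; apply: eq_bigr => j _.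
  by rewrite -fE mulr_sumr; apply: eq_bigr => t _; rewrite mulrCA.
apply: (@le_trans _ _ (\sum_t w t * (K + k * (cov f f - cov f (P t))))).
  apply: ler_sum => t _; have [->|wt] := w_pos t; first by rewrite !mul0r.
  have [P1 PtK] := PK t wt; rewrite ler_wpM2l //.
  by apply: le_trans (distinct_le_surrogate k0 P1 f1) _; rewrite lerD2r.
rewrite (_ : \sum_t _ = (\sum_t w t) * (K + k * cov f f) - k * \sum_t w t * cov f (P t)).
  by rewrite w1 covP mul1r addrK.
by rewrite mulr_suml mulr_sumr -sumrB; apply: eq_bigr => t _; ring.
Qed.

End Share.

(* The value of [surrogate k] at the uniform law on n of b symbols when
   [cov (share p) (share p)] is replaced by [E * cov p (share p)]. *)
Definition uniform_value (R : realFieldType) (b m : nat) (k E : R) (n : nat) : R :=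
  let e := birthday R n m.+1 / m.+1`!%:R in
  (1 - m.+1%:R / b%:R) * e
  + (n%:R^-1 - b%:R^-1) * (k / 4 + (E / (4 * k) - 2^-1) * (m.+1%:R * e)).

Lemma surrogate_le (R : realType) (T : finType) (m : nat) (S : {set T}) (k E K : R)
    (p : T -> R) :
  (0 < #|T|)%N -> 0 < k -> law S p ->
  cov (share m p) (share m p) <= E * cov p (share m p) ->
  (forall n, (0 < n <= #|S|)%N -> uniform_value #|T| m k E n <= K) -> surrogate m k p <= K.
Proof.
move=> T_gt0 k0 pS varE uniK; have [p0 _ p1] := pS.
have k_neq0 : k != 0 by rewrite gt_eqF.
have b_neq0 : #|T|%:R != 0 :> R by rewrite pnatr_eq0 -lt0n.
pose q := (E / k - 2) / 4.
pose c : seq (R * nat) := [:: (k / 4 * (1 - #|T|%:R^-1), 0%N); (- (k / 2), 2%N);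
  ((1 + q) * (1 - m.+1%:R / #|T|%:R), m.+1); (- (q * m.+2%:R), m.+2)].
have combE : elsym_comb c p =
    (1 - m.+1%:R / #|T|%:R) * elsym [set: T] p m.+1
    + (k * cov p p - 2 * cov p (share m p) + E * cov p (share m p) / k) / 4.
  rewrite /elsym_comb !big_cons big_nil /= elsym0 cov_law // cov_share // /q; field.
  by rewrite b_neq0 k_neq0.
apply: (@le_trans _ _ (elsym_comb c p)).
  by rewrite combE /surrogate lerD2l ler_pM2r ?invr_gt0 // lerD2l ler_pM2r ?invr_gt0.
apply: elsym_comb_le pS => n /[dup] /andP[n0 _] /uniK; congr (_ <= _).
have n_neq0 : n%:R != 0 :> R by rewrite pnatr_eq0 -lt0n.
have fact_neq0 : m.+1`!%:R != 0 :> R by rewrite pnatr_eq0 -lt0n fact_gt0.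
rewrite /elsym_comb_uniform !big_cons big_nil /= [birthday R n m.+2]birthdayS [m.+2`!]factS natrM.
rewrite -[0`!]/1%N -[2`!]/2%N [birthday R n 2]birthdayS [birthday R n 1]birthdayS birthday0.
rewrite /uniform_value /q; field.
by rewrite fact_neq0 -natrD pnatr_eq0 n_neq0 k_neq0 b_neq0.
Qed.

(** * Contribution of a coordinate *)

Section UniformInequalities.
Variables (R : realType) (b m : nat).
Hypotheses (m_gt0 : (0 < m)%N) (mb : (m.+1 < b)%N).

Definition relative_gap n : R := b%:R / n%:R - 1.

Definition birthday_ratio n r : R :=
  \prod_(1 <= j < r) ((n - j)%:R / (b - j)%:R * (b%:R / n%:R)).

Definition distinct_uniform : R := birthday R b m.+2 / m.+1`!%:R.

(* The largest slope for which [uniform_value] is at most [distinct_uniform] at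
   point masses. *)
Definition slope : R := 4 * distinct_uniform * b%:R / (b%:R - 1).

Definition window_factor : R := 2 / (b%:R - 1).

Definition penalty : R :=
  (m.+1%:R / 16 * (b%:R / (b - 2)%:R) ^+ m - 2^-1) * (m.+1%:R / (b - m.+1)%:R).

Definition free_condition : bool := penalty <= \sum_(2 <= j < m.+1) j%:R / (b - j)%:R.

(* The inequality of [uniform_value_window_le] at n = m + 1, divided by its
   right-hand side. *)
Definition window_condition : bool :=
  let y := (b - 1)%:R / 2 * birthday_ratio m.+1 m.+1 in
  y / 2 + y ^+ 2 * (m.+1%:R * (b - 1)%:R / (16 * (b - m.+1)%:R))
    <= b%:R / (b - 1)%:R * (m%:R / m.+1%:R) :> R.

Let b_gt0 : 0 < b%:R :> R. Proof. by rewrite ltr0n (leq_trans _ mb). Qed.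
Let b1_gt0 : 0 < b%:R - 1 :> R. Proof. by rewrite subr_gt0 ltr1n (leq_trans _ mb). Qed.
Let bm_gt0 : 0 < b%:R - m.+1%:R :> R. Proof. by rewrite subr_gt0 ltr_nat. Qed.

Lemma relative_gap_ge0 n : (0 < n <= b)%N -> 0 <= relative_gap n.
Proof. by move=> /andP[n0 nb]; rewrite subr_ge0 ler_pdivlMr ?ltr0n // mul1r ler_nat. Qed.

Lemma relative_gap_le1 n : (0 < n)%N -> relative_gap n / (b%:R - 1) <= 1.
Proof.
move=> n0; rewrite ler_pdivrMr // mul1r lerD2r ler_pdivrMr ?ltr0n //.
by rewrite ler_peMr ?ler1n // ltW.
Qed.

Lemma birthday_ratioE n r : (0 < r <= n)%N -> (n <= b)%N ->
  birthday R n r = birthday R b r * birthday_ratio n r.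
Proof.
move=> /andP[r0 rn] nb; have n_gt0 := leq_trans r0 rn.
rewrite /birthday -!(big_mkord xpredT (fun j => 1 - j%:R / _)) !(big_ltn r0) /=.
rewrite /birthday_ratio !mul0r !subr0 !mul1r -big_split /=; apply: eq_big_nat => j /andP[_ jr].
have [jn jb] : (j < n)%N /\ (j < b)%N by split; rewrite ?(leq_trans jr) // (leq_trans rn).
have bj : 0 < b%:R - j%:R :> R by rewrite subr_gt0 ltr_nat.
have n0 : 0 < n%:R :> R by rewrite ltr0n.
by rewrite !natrB 1?ltnW //; field; rewrite !gt_eqF.
Qed.

Lemma birthday_ratio_ge0 n r : 0 <= birthday_ratio n r.
Proof. by apply: prodr_ge0 => j _; rewrite mulr_ge0 ?divr_ge0. Qed.

Lemma birthday_ratio_le_expR n : (m < n <= b)%N ->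
  birthday_ratio n m.+1 <= (1 - relative_gap n / (b%:R - 1)) *
    expR (- (relative_gap n * \sum_(2 <= j < m.+1) j%:R / (b - j)%:R)).
Proof.
move=> /andP[mn nb]; have n0 := leq_ltn_trans (leq0n m) mn.
have factorE j : (j <= m)%N -> (n - j)%:R / (b - j)%:R * (b%:R / n%:R) =
    1 - relative_gap n * (j%:R / (b - j)%:R).
  move=> jm; have jb : (j < b)%N := leq_ltn_trans jm (ltnW mb).
  have bj : 0 < b%:R - j%:R :> R by rewrite subr_gt0 ltr_nat.
  have n_gt0 : 0 < n%:R :> R by rewrite ltr0n.
  rewrite /relative_gap !natrB ?(ltnW jb) ?(leq_trans jm (ltnW mn)) //; field.
  by rewrite !gt_eqF.
rewrite /birthday_ratio big_ltn // [X in X * _ <= _]factorE // mul1r natrB ?(leq_trans _ mb) //.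
apply: ler_wpM2l; first by rewrite subr_ge0 relative_gap_le1.
rewrite mulr_sumr -sumrN expR_sum big_nat_cond [leRHS]big_nat_cond.
apply: ler_prod => j /andP[/andP[_ jm] _]; rewrite mulr_ge0 ?divr_ge0 // factorE //=.
exact: expR_ge1Dx.
Qed.

(* The estimate [1 - x <= expR (- x)] turns the product into a sum, so that one
   condition on b and m settles all n. *)
Lemma birthday_ratio_penalty_le n : free_condition -> (m < n <= b)%N ->
  birthday_ratio n m.+1 * (1 + relative_gap n * penalty) <= 1 - relative_gap n / (b%:R - 1).
Proof.
rewrite /free_condition => free_ok /[dup] mnb /andP[mn nb].
have n0 := leq_ltn_trans (leq0n m) mn.
apply: le_trans (ler_wpM2l (birthday_ratio_ge0 _ _) (expR_ge1Dx _)) _.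
apply: le_trans (ler_wpM2r (expR_ge0 _) (birthday_ratio_le_expR mnb)) _.
rewrite -mulrA -expRD; apply: ler_piMr; first by rewrite subr_ge0 relative_gap_le1.
by rewrite expR_le1 addrC subr_le0 ler_wpM2l // relative_gap_ge0 ?n0.
Qed.

Lemma distinct_uniformE :
  distinct_uniform = (1 - m.+1%:R / b%:R) * (birthday R b m.+1 / m.+1`!%:R).
Proof. by rewrite /distinct_uniform birthdayS; ring. Qed.

Lemma distinct_uniform_gt0 : 0 < distinct_uniform.
Proof. by rewrite divr_gt0 // birthday_gt0 // (leq_trans _ mb). Qed.

Lemma slope_gt0 : 0 < slope.
Proof. by have u_gt0 := distinct_uniform_gt0; rewrite divr_gt0 // mulr_gt0 // mulr_gt0. Qed.

Lemma window_factor_gt0 : 0 < window_factor. Proof. exact: divr_gt0. Qed.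

Lemma birthday_div_slope :
  birthday R (b - 2) m / m`!%:R / (4 * slope) = m.+1%:R / 16 * (b%:R / (b - 2)%:R) ^+ m.
Proof.
have b2 : (2 < b)%N by rewrite (leq_trans _ mb).
have b2_gt0 : 0 < (b - 2)%:R :> R by rewrite ltr0n subn_gt0.
rewrite /slope /distinct_uniform !birthdayE ?subn_gt0 // ?(ltnW (ltnW b2)) //.
have -> : (b ^_ m.+2 = b * b.-1 * (b - 2) ^_ m)%N by rewrite subn2 !ffactnS mulnA.
have b1E : b.-1%:R = b%:R - 1 :> R by rewrite -subn1 natrB // (ltnW (ltnW b2)).
have ffact_neq0 : ((b - 2) ^_ m)%:R != 0 :> R.
  by rewrite pnatr_eq0 -lt0n ffact_gt0 leq_subRL ?(ltnW b2) // add2n.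
have m_neq0 : m`!%:R != 0 :> R by rewrite pnatr_eq0 -lt0n fact_gt0.
rewrite factS !natrX !exprS expr_div_n !natrM b1E; field.
by rewrite nat1r ffact_neq0 m_neq0 !lt0r_neq0 ?exprn_gt0.
Qed.

Lemma uniform_value_small (k E : R) n : (0 < n < m.+1)%N ->
  uniform_value b m k E n = (n%:R^-1 - b%:R^-1) * (k / 4).
Proof. by move=> nm; rewrite /uniform_value birthday_small // mul0r !mulr0 addr0 add0r. Qed.

Lemma slope_mul_le n : (0 < n)%N -> (n%:R^-1 - b%:R^-1) * (slope / 4) <= distinct_uniform.
Proof.
move=> n0; have n_gt0 : 0 < n%:R :> R by rewrite ltr0n.
have -> : (n%:R^-1 - b%:R^-1) * (slope / 4) =
    distinct_uniform * (relative_gap n / (b%:R - 1)).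
  by rewrite /slope /relative_gap; field; rewrite !gt_eqF.
by rewrite ler_piMr ?relative_gap_le1 // ltW // distinct_uniform_gt0.
Qed.

Lemma uniform_value_freeE n : (m < n <= b)%N ->
  uniform_value b m slope (birthday R (b - 2) m / m`!%:R) n =
  distinct_uniform * (relative_gap n / (b%:R - 1)
    + birthday_ratio n m.+1 * (1 + relative_gap n * penalty)).
Proof.
move=> /andP[mn nb]; have n_gt0 : 0 < n%:R :> R by rewrite ltr0n (leq_ltn_trans _ mn).
rewrite /uniform_value birthday_div_slope (birthday_ratioE (r := m.+1)) //.
rewrite /slope distinct_uniformE /penalty /relative_gap [(b - m.+1)%:R]natrB 1?ltnW //.
by field; rewrite nat1r !gt_eqF // ltr0n subn_gt0 (leq_trans _ mb).
Qed.

Lemma uniform_value_free_le n : free_condition -> (0 < n <= b)%N ->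
  uniform_value b m slope (birthday R (b - 2) m / m`!%:R) n <= distinct_uniform.
Proof.
move=> free_ok /andP[n0 nb]; have [nm|mn] := ltnP n m.+1.
  by rewrite uniform_value_small ?n0 // slope_mul_le.
rewrite uniform_value_freeE ?mn // ler_piMr //; first exact/ltW/distinct_uniform_gt0.
by rewrite -lerBrDl birthday_ratio_penalty_le // mn.
Qed.

Lemma uniform_value_window_le n : window_condition -> (0 < n <= m.+1)%N ->
  uniform_value b m (window_factor * slope)
    (m.+1%:R * (birthday R m.+1 m.+1 / m.+1`!%:R)) n <= window_factor * distinct_uniform.
Proof.
rewrite /window_condition => window_ok /andP[n0].
rewrite leq_eqVlt => /predU1P[->|nm]; last first.
  rewrite uniform_value_small ?n0 // -mulrA mulrCA ler_pM2l ?window_factor_gt0 //.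
  exact: slope_mul_le.
have u_gt0 := distinct_uniform_gt0; have factor_gt0 := window_factor_gt0.
set y := (b - 1)%:R / 2 * _ in window_ok.
have eE : birthday R m.+1 m.+1 / m.+1`!%:R =
    window_factor * distinct_uniform * y * (b%:R / (b%:R - m.+1%:R)).
  rewrite (birthday_ratioE (r := m.+1)) ?leqnn 1?ltnW // distinct_uniformE /window_factor /y.
  by rewrite natrB ?(leq_trans _ mb) //; field; rewrite ?nat1r !gt_eqF.
move: window_ok; rewrite -(ler_pM2l (mulr_gt0 factor_gt0 u_gt0)) -subr_ge0.
rewrite -[_ <= window_factor * distinct_uniform]subr_ge0; congr (_ <= _).
rewrite /uniform_value eE !natrB ?(leq_trans _ mb) 1?ltnW // -[m.+1%:R]natr1 /slope.
by field; rewrite !natr1 !gt_eqF.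
Qed.

End UniformInequalities.

Section MixtureOfLaws.
Variables (R : realType) (T I : finType) (m : nat).
Variables (w : I -> R) (P : I -> T -> R) (f : T -> R).
Hypotheses (m_gt0 : (0 < m)%N) (mT : (m.+1 < #|T|)%N).
Hypotheses (w_ge0 : forall t, 0 <= w t) (w_sum : \sum_t w t = 1).
Hypothesis mean : forall j, \sum_t w t * P t j = f j.

Let T_gt0 : (0 < #|T|)%N. Proof. exact: leq_ltn_trans mT. Qed.

Lemma distinct_mixture_free_le : free_condition R #|T| m ->
  (forall t, 0 < w t -> law [set: T] (P t)) ->
  \sum_t w t * distinct m (P t) f <= distinct_uniform R #|T| m.
Proof.
move=> free_ok lawP; apply: (distinct_mixture_le T_gt0 (slope_gt0 R mT)) => // t /lawP Pt.
have [P0 _ P1] := Pt; split=> //.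
apply: (surrogate_le T_gt0 (slope_gt0 R mT) Pt (E := birthday R (#|T| - 2) m / m`!%:R)).
  apply: share_var_le => // i j ij.
  have cardD2 : #|[set: T] :\ i :\ j| = (#|T| - 2)%N.
    rewrite -[#|T|]cardsT (cardsD1 i [set: T]) (cardsD1 j ([set: T] :\ i)).
    by rewrite !inE eq_sym ij !add1n subn2.
  rewrite -cardD2; apply: elsym_sublaw_le => //; last first.
    by rewrite cardD2 subn_gt0 (leq_ltn_trans _ mT).
  by rewrite -P1 [leRHS](bigID (mem ([set: T] :\ i :\ j))) /= lerDl sumr_ge0.
by move=> n; rewrite cardsT => nT; exact: uniform_value_free_le.
Qed.

Lemma distinct_mixture_window_le (S : I -> {set T}) : window_condition R #|T| m ->
  (forall t, 0 < w t -> law (S t) (P t)) -> (forall t, #|S t| = m.+1) ->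
  \sum_t w t * distinct m (P t) f <= window_factor R #|T| * distinct_uniform R #|T| m.
Proof.
move=> window_ok lawP cardS.
have k_gt0 : 0 < window_factor R #|T| * slope R #|T| m.
  exact: mulr_gt0 (window_factor_gt0 R mT) (slope_gt0 R mT).
apply: (distinct_mixture_le T_gt0 k_gt0) => // t /lawP Pt.
have [P0 _ P1] := Pt; split=> //.
pose E : R := m.+1%:R * (birthday R m.+1 m.+1 / m.+1`!%:R).
apply: (surrogate_le T_gt0 k_gt0 Pt (E := E)).
  rewrite (share_var_supp T_gt0 Pt) //; apply: ler_wpM2r.
    rewrite cov_share // (elsym_law m.+2 Pt) [elsym (S t) _ _]elsym_card ?cardS // mulr0 subr0.
    by rewrite mulr_ge0 ?elsym_ge0 // subr_ge0 ler_pdivrMr ?ltr0n // mul1r ler_nat ltnW.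
  by rewrite ler_wpM2l // (elsym_law m.+1 Pt) -(cardS t) elsym_law_le.
by move=> n; rewrite cardS => nm; exact: uniform_value_window_le.
Qed.

End MixtureOfLaws.

(** * Hansel's lemma *)

(* Jensen's inequality for the exponential, by comparison with its tangent. *)
Lemma ln_card_le_kraft (R : realType) (K : finType) (Y : {set K}) (d : R) (deg : K -> nat) :
  0 < d -> \sum_(y in Y) (d ^+ deg y)^-1 <= 1 ->
  #|Y|%:R * ln #|Y|%:R <= ln d * \sum_(y in Y) (deg y)%:R.
Proof.
move=> d0 kraft; have [Y0|Y0] := posnP #|Y|.
  by rewrite (cards0_eq Y0) big_set0 cards0 mul0r mulr0.
have YR : 0 < #|Y|%:R :> R by rewrite ltr0n.
have sumY (z : R) : \sum_(y in Y) z = #|Y|%:R * z by rewrite sumr_const mulr_natl.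
have : \sum_(y in Y) (1 + (ln #|Y|%:R - (deg y)%:R * ln d)) <= #|Y|%:R.
  rewrite -[leRHS]mulr1; apply: le_trans (ler_wpM2l (ltW YR) kraft).
  rewrite mulr_sumr; apply: ler_sum => y _; apply: le_trans (expR_ge1Dx _) _.
  by rewrite expRD lnK ?posrE // expRN expRM_natl lnK ?posrE.
by rewrite big_split sumrB /= -mulr_suml !sumY; lra.
Qed.

Section Hansel.
Variables (R : realType) (b r n : nat) (C : {set n.-tuple 'I_b}).
Local Notation word := (n.-tuple 'I_b).
Implicit Types (x : {ffun 'I_r -> word}) (y : word) (i : 'I_n) (a : 'I_b).

Definition symbols x i : {ffun 'I_r -> 'I_b} := [ffun j => tnth (x j) i].

Definition separates x i y : bool :=
  injectiveb (symbols x i) && (tnth y i \notin codom (symbols x i)).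

Definition degree x y : nat := \sum_i separates x i y.

Lemma hash_code_separates x y y' : hash_code r.+2 C -> injective x ->
  (forall j, x j \in C) -> y \in C -> y' \in C -> y \notin codom x ->
  y' \notin codom x -> y != y' ->
  exists i, [&& separates x i y, separates x i y' & tnth y i != tnth y' i].
Proof.
move=> hC xi xC yC y'C yx y'x yy'.
pose S := y |: (y' |: [set x j | j : 'I_r]).
have Sx j : x j \in S by rewrite !inE imset_f ?orbT.
have Sy : y \in S by rewrite !inE eqxx.
have Sy' : y' \in S by rewrite !inE eqxx orbT.
have [||i iinj] := hC S.
- by apply/subsetP => w; rewrite !inE => /or3P[/eqP->|/eqP->|/imsetP[j _ ->]].
- have im w : (w \in [set x j | j : 'I_r]) = (w \in codom x).
    by apply/imsetP/codomP => [[j _ ->]|[j ->]]; exists j.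
  by rewrite !cardsU1 card_imset // card_ord !inE !im (negbTE yx) (negbTE y'x) (negbTE yy').
have sinj : injectiveb (symbols x i).
  by apply/injectiveP => j j'; rewrite !ffunE => /(iinj _ _ (Sx j) (Sx j'))/xi.
have sep w : w \in S -> w \notin codom x -> separates x i w.
  move=> Sw wx; rewrite /separates sinj /=; apply: contra wx => /codomP[j].
  by rewrite ffunE => /(iinj _ _ Sw (Sx j)) ->; rewrite codom_f.
exists i; rewrite !sep //=; apply: contra yy' => /eqP/(iinj _ _ Sy Sy')/eqP.
exact.
Qed.

Definition free_symbols x i : pred 'I_b :=
  [pred a | injectiveb (symbols x i) ==> (a \notin codom (symbols x i))].

Definition compatible_symbols x y i : pred 'I_b :=
  [pred a | if separates x i y then a == tnth y i else free_symbols x i a].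

Lemma card_free_symbols x i : injectiveb (symbols x i) -> #|free_symbols x i| = (b - r)%N.
Proof.
move=> si; have := cardC (mem (codom (symbols x i))).
rewrite card_codom ?card_ord; last exact/injectiveP.
move=> /(congr1 (subn^~ r)); rewrite addKn => <-; apply: eq_card => a.
by rewrite !inE si.
Qed.

Lemma card_compatible_family x y :
  (#|family (compatible_symbols x y)| * (b - r) ^ degree x y = #|family (free_symbols x)|)%N.
Proof.
rewrite !card_family_prod /degree expn_sum -big_split; apply: eq_bigr => i _ /=.
have [/[dup] sy /andP[si _]|/negbTE sy] := boolP (separates x i y).
  rewrite card_free_symbols // expn1 (eq_card (B := pred1 (tnth y i))) ?card1 ?mul1n //.
  by move=> a; rewrite !inE sy.
by rewrite expn0 muln1; apply: eq_card => a; rewrite !inE sy.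
Qed.

(* Colour each coordinate by a symbol avoiding x: two words compatible with the
   same colouring would not be separated anywhere. *)
Lemma kraft_degree x (Y : {set word}) : hash_code r.+2 C -> injective x ->
  (forall j, x j \in C) -> (r < b)%N -> Y \subset C ->
  (forall y, y \in Y -> y \notin codom x) ->
  \sum_(y in Y) ((b - r)%:R ^+ degree x y)^-1 <= 1 :> R.
Proof.
move=> hC xi xC rb /subsetP YC Yx.
have free_gt0 : (0 < #|family (free_symbols x)|)%N.
  rewrite card_family_prod prodn_gt0 // => i.
  have [si|/negbTE si] := boolP (injectiveb (symbols x i)).
    by rewrite card_free_symbols // subn_gt0.
  by apply/card_gt0P; exists (Ordinal (leq_ltn_trans (leq0n r) rb)); rewrite inE si.
have le_free : (\sum_(y in Y) #|family (compatible_symbols x y)| <= #|family (free_symbols x)|)%N.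
  apply: sum_card_family_le => [y i a|y y' yY y'Y yy']; rewrite ?inE.
    by case: ifP => // /andP[-> ny] /eqP ->.
  have [i /and3P[sy sy' neq]] :=
    hash_code_separates hC xi xC (YC _ yY) (YC _ y'Y) (Yx _ yY) (Yx _ y'Y) yy'.
  exists i; apply/pred0P => a; rewrite !inE sy sy' /=.
  by apply/negP => /andP[/eqP ->]; apply/negP.
have degE y : ((b - r)%:R ^+ degree x y)^-1 =
    #|family (compatible_symbols x y)|%:R / #|family (free_symbols x)|%:R :> R.
  move: free_gt0; rewrite -(card_compatible_family x y) muln_gt0 => /andP[comp_gt0 _].
  by rewrite natrM natrX invfM mulrA mulfV ?mul1r // pnatr_eq0 -lt0n.
under eq_bigr do rewrite degE.
by rewrite -mulr_suml -natr_sum ler_pdivrMr ?ltr0n // mul1r ler_nat.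
Qed.

Lemma hansel x : hash_code r.+2 C -> injective x -> (forall j, x j \in C) -> (r < b)%N ->
  (#|C| - r)%:R * ln (#|C| - r)%:R <=
  ln (b - r)%:R * \sum_i #|[set y in C | separates x i y]|%:R :> R.
Proof.
move=> hC xi xC rb; pose Y := [set y in C | y \notin codom x].
have Ycard : #|Y| = (#|C| - r)%N.
  have := cardsID [set y | y \in codom x] C.
  rewrite (_ : #|C :&: _| = r) => [<-|].
    by rewrite addKn; apply: eq_card => y; rewrite !inE andbC.
  rewrite -[RHS]card_ord -(card_codom xi); apply: eq_card => y; rewrite !inE.
  by rewrite andb_idl // => /codomP[j ->].
have -> : \sum_i #|[set y in C | separates x i y]|%:R = \sum_(y in Y) (degree x y)%:R :> R.
  rewrite -!natr_sum; congr (_%:R); rewrite /degree exchange_big; apply: eq_bigr => i _ /=.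
  rewrite -sum1_card big_mkcond [RHS]big_mkcond; apply: eq_bigr => y _ /=.
  rewrite !inE; case: (y \in C) => //=; have [/codomP[j ->]|_] := boolP (y \in codom x).
    by rewrite /separates -[tnth _ _](ffunE (fun j => tnth (x j) i)) codom_f andbF.
  by case: separates.
rewrite -Ycard; apply: ln_card_le_kraft; first by rewrite ltr0n subn_gt0.
apply: kraft_degree => // [|y]; last by rewrite inE => /andP[].
by apply/subsetP => y; rewrite inE => /andP[].
Qed.

End Hansel.

(** * Averaging over boxes *)

(* The left-hand side of [hansel] divided by the number N of codewords. *)
Definition trimmed_ln (R : realType) (r N : nat) : R := (N - r)%:R / N%:R * ln (N - r)%:R.

Lemma trimmed_ln_ge0 (R : realType) r N : 0 <= trimmed_ln R r N.
Proof. by rewrite mulr_ge0 ?divr_ge0 ?ln_natr_ge0. Qed.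

Section SubcodeAverage.
Variables (R : realType) (b r n : nat).
Local Notation word := (n.-tuple 'I_b).
Implicit Types (C D : {set word}) (x : {ffun 'I_r -> word}) (i : 'I_n) (a : 'I_b).

Definition symcount D i a : R := #|[set w in D | tnth w i == a]|%:R.

Definition symlaw D i a : R := symcount D i a / #|D|%:R.

Lemma symcountE D i a : D != set0 -> symcount D i a = #|D|%:R * symlaw D i a.
Proof. by move=> D0; rewrite mulrC divfK // pnatr_eq0 cards_eq0. Qed.

Lemma symlaw_ge0 D i a : 0 <= symlaw D i a.
Proof. by rewrite divr_ge0. Qed.

Lemma sum_symlaw D i : D != set0 -> \sum_a symlaw D i a = 1.
Proof.
move=> D0; rewrite -mulr_suml -natr_sum (_ : (\sum_a _)%N = #|D|).
  by rewrite mulfV // pnatr_eq0 cards_eq0.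
rewrite -[in RHS]sum1_card (partition_big (fun w => tnth w i) xpredT) //=.
by apply: eq_bigr => a _; rewrite -sum1_card; apply: eq_bigl => w; rewrite inE.
Qed.

Lemma law_symlaw D i (S : {set 'I_b}) : D != set0 -> {in D, forall w, tnth w i \in S} ->
  law S (symlaw D i).
Proof.
move=> D0 DS; split=> [a|a aS|]; [exact: symlaw_ge0| |exact: sum_symlaw].
rewrite /symlaw /symcount (_ : #|_| = 0%N) ?mul0r //; apply: eq_card0 => w.
by rewrite !inE; apply: contraNF aS => /andP[/DS wS /eqP <-].
Qed.

Lemma sum_symbols D i (G : {ffun 'I_r -> 'I_b} -> R) :
  \sum_(x : {ffun 'I_r -> word} | x \in ffun_on (mem D)) G (symbols x i) =
  \sum_s G s * \prod_j symcount D i (s j).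
Proof.
rewrite (partition_big (fun x => symbols x i) xpredT) //=; apply: eq_bigr => s _.
rewrite (eq_bigr (fun=> G s)) => [|x /andP[_ /eqP -> //]].
rewrite sumr_const -mulr_natr -natr_prod; congr (_ * _%:R).
transitivity #|family (fun j => [pred w | (w \in D) && (tnth w i == s j)])|; last first.
  by rewrite card_family_prod; apply: eq_bigr => j _; apply: eq_card => w; rewrite !inE.
apply: eq_card => x; rewrite unfold_in.
apply/andP/familyP => [[/ffun_onP xD /eqP <-] j|xF].
  by rewrite inE ffunE eqxx andbT; exact: xD.
split; first by apply/ffun_onP => j; have := xF j; rewrite inE => /andP[].
by apply/eqP/ffunP => j; rewrite ffunE; apply/eqP; have := xF j; rewrite inE => /andP[].
Qed.

Lemma card_separated C x i : #|[set y in C | separates x i y]|%:R =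
  \sum_a symcount C i a * (injectiveb (symbols x i) && (a \notin codom (symbols x i)))%:R.
Proof.
rewrite -sum1_card natr_sum (partition_big (fun y => tnth y i) xpredT) //=.
apply: eq_bigr => a _; rewrite -natr_sum sum1_card -natrM; congr (_%:R).
set sep := injectiveb _ && _; have [sepT|/negbTE sepF] := boolP sep.
  rewrite muln1; apply: eq_card => y; rewrite unfold_in !inE /separates.
  by case: eqP => [->|]; rewrite ?andbF // -/sep sepT andbT.
rewrite muln0; apply: eq_card0 => y; rewrite unfold_in !inE /separates.
by case: eqP => [->|]; rewrite ?andbF // -/sep sepF andbF.
Qed.

Lemma sum_card_separated C D i :
  \sum_(x : {ffun 'I_r -> word} | x \in ffun_on (mem D)) #|[set y in C | separates x i y]|%:R =
  r`!%:R * \sum_a symcount C i a * elsym ([set: 'I_b] :\ a) (symcount D i) r.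
Proof.
under eq_bigr do rewrite card_separated.
rewrite exchange_big mulr_sumr /=; apply: eq_bigr => a _.
rewrite -mulr_sumr mulrCA -sum_injective_prod; congr (_ * _).
rewrite (sum_symbols D i (fun s => (injectiveb s && (a \notin codom s))%:R)).
rewrite [RHS]big_mkcond; apply: eq_bigr => s _ /=.
have -> : (codom s \subset [set: 'I_b] :\ a) = (a \notin codom s).
  apply/subsetP/idP => [sub|as_ l ls]; last by rewrite !inE andbT; apply: contraNneq as_ => <-.
  by apply/negP => /sub; rewrite !inE eqxx.
by case: ifP; rewrite ?mul1r ?mul0r.
Qed.

Lemma sum_card_separated_symlaw C D i : C != set0 -> D != set0 ->
  \sum_(x : {ffun 'I_r -> word} | x \in ffun_on (mem D)) #|[set y in C | separates x i y]|%:R =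
  #|C|%:R * #|D|%:R ^+ r *
    (r`!%:R * \sum_a symlaw C i a * elsym ([set: 'I_b] :\ a) (symlaw D i) r).
Proof.
move=> C0 D0; rewrite sum_card_separated mulrCA; congr (_ * _); rewrite mulr_sumr.
apply: eq_bigr => a _; rewrite (symcountE _ _ C0) [RHS]mulrACA -elsymZ; congr (_ * _).
by apply: eq_elsym => l _; exact: symcountE.
Qed.

Lemma sum_hansel_le C D : hash_code r.+2 C -> (r < b)%N -> D \subset C ->
  (#|D| ^_ r)%:R * ((#|C| - r)%:R * ln (#|C| - r)%:R) <= ln (b - r)%:R *
    \sum_i \sum_(x : {ffun 'I_r -> word} | x \in ffun_on (mem D))
      #|[set y in C | separates x i y]|%:R :> R.
Proof.
move=> hC rb DC; have := card_inj_ffuns_on 'I_r (mem D); rewrite card_ord => <-.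
rewrite mulr_natl -sumr_const exchange_big mulr_sumr.
rewrite [leRHS](bigID (fun x : {ffun _ -> _} => injectiveb x)) /=.
under eq_bigl do rewrite inE.
apply: ler_wpDr; first by apply: sumr_ge0 => x _; rewrite mulr_ge0 ?ln_natr_ge0 ?sumr_ge0.
apply: ler_sum => x /andP[/ffun_onP xD /injectiveP xi].
by apply: hansel => // j; apply: (subsetP DC); exact: xD.
Qed.

End SubcodeAverage.

Lemma hansel_subcode (R : realType) (b m n : nat) (C D : {set n.-tuple 'I_b}) :
  hash_code m.+3 C -> (m.+1 < b)%N -> D \subset C -> D != set0 ->
  (1 - m.+1%:R ^+ 2 / #|D|%:R) * trimmed_ln R m.+1 #|C| <=
  ln (b - m.+1)%:R * m.+1`!%:R * \sum_i distinct m (symlaw R D i) (symlaw R C i).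
Proof.
move=> hC mb DC D0; have d0 : 0 < #|D|%:R :> R by rewrite ltr0n card_gt0.
have C0 : C != set0 by apply: contraNneq D0 => C0; rewrite C0 subset0 in DC.
have c0 : 0 < #|C|%:R :> R by rewrite ltr0n card_gt0.
have hansel_le := sum_hansel_le R hC mb DC.
set T := _ * ln _ in hansel_le.
have T0 : 0 <= T by rewrite mulr_ge0 // ln_natr_ge0.
have ge_birthday : #|D|%:R ^+ m.+1 * (1 - m.+1%:R ^+ 2 / #|D|%:R) <= (#|D| ^_ m.+1)%:R :> R.
  apply: le_trans (ler_wpM2l _ (birthday_ge R m.+1 _)) _; rewrite ?card_gt0 ?exprn_ge0 //.
  by rewrite birthdayE ?card_gt0 // natrX mulrC divfK // expf_neq0 // gt_eqF.
rewrite -(ler_pM2l (mulr_gt0 c0 (exprn_gt0 m.+1 d0))).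
have -> : #|C|%:R * #|D|%:R ^+ m.+1 * ((1 - m.+1%:R ^+ 2 / #|D|%:R) * trimmed_ln R m.+1 #|C|) =
    #|D|%:R ^+ m.+1 * (1 - m.+1%:R ^+ 2 / #|D|%:R) * T.
  by rewrite /T /trimmed_ln; field; rewrite !gt_eqF.
apply: le_trans (ler_wpM2r T0 ge_birthday) (le_trans hansel_le _).
rewrite [leRHS]mulrCA -[leRHS]mulrA ler_wpM2l ?ln_natr_ge0 // !mulr_sumr.
by apply: ler_sum => i _; rewrite sum_card_separated_symlaw // mulrCA.
Qed.

(* The bound on the rate given by Hansel's lemma for codewords drawn from the
   whole code. *)
Definition full_rate (R : realType) (b m : nat) : R := ln (b - m.+1)%:R * birthday R b m.+2.

Section Boxes.
Variables (R : realType) (b' m n l : nat).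
Local Notation b := b'.+1.
Local Notation word := (n.-tuple 'I_b).
Implicit Types (t a : 'I_b) (w : word) (o : {ffun 'I_n -> 'I_b}) (i : 'I_n).
Hypotheses (m_gt0 : (0 < m)%N) (mb : (m.+1 < b)%N) (le_ln : (l <= n)%N).

(* Cyclic intervals of length m+1, so that every symbol lies in exactly m+1 of
   the b windows. *)
Definition window t : {set 'I_b} := [set a | ((a - t)%R < m.+1)%N].

Lemma card_initial_segment : #|[set a : 'I_b | (a < m.+1)%N]| = m.+1.
Proof.
by rewrite cardsE -sum1_card -(big_ord_widen b (fun=> 1%N) (ltnW mb)) sum1_card card_ord.
Qed.

Lemma card_window t : #|window t| = m.+1.
Proof.
rewrite -[RHS]card_initial_segment -[RHS](card_preimset _ (addIr (- t))).
by apply: eq_card => a; rewrite !inE.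
Qed.

Lemma card_windows_of a : #|[set t | a \in window t]| = m.+1.
Proof.
rewrite -[RHS]card_initial_segment -[RHS](card_preimset _ (@subrI _ a)).
by apply: eq_card => t; rewrite !inE.
Qed.

Definition in_box o w : bool := [forall i : 'I_n, (i < l)%N ==> (tnth w i \in window (o i))].

Definition boxes_per_word : nat := m.+1 ^ l * b ^ (n - l).

Lemma card_boxes_of w : #|[set o | in_box o w]| = boxes_per_word.
Proof.
transitivity #|family (fun i : 'I_n => [pred t | (i < l)%N ==> (tnth w i \in window t)])|.
  by apply: eq_card => o; rewrite inE; apply/forallP/familyP => wo i; exact: wo.
rewrite card_family_prod (eq_bigr (fun i : 'I_n => if (i < l)%N then m.+1 else b)); last first.
  move=> i _; case: ifP => _; last by rewrite -[RHS]card_ord; exact: eq_card.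
  by rewrite -(card_windows_of (tnth w i)); apply: eq_card => t; rewrite inE.
by rewrite (big_ord_ifltn _ _ _ le_ln) /= !prod_nat_const !card_ord.
Qed.

Variable C : {set word}.
Hypothesis C0 : C != set0.

Definition box_code o : {set word} := [set w in C | in_box o w].

Definition box_weight o : R := #|box_code o|%:R / (#|C|%:R * boxes_per_word%:R).

Let C_gt0 : 0 < #|C|%:R :> R. Proof. by rewrite ltr0n card_gt0. Qed.
Let boxes_gt0 : 0 < boxes_per_word%:R :> R. Proof. by rewrite ltr0n muln_gt0 !expn_gt0. Qed.

Lemma box_weight_ge0 o : 0 <= box_weight o.
Proof. by rewrite divr_ge0 ?mulr_ge0. Qed.

Lemma box_code_neq0 o : 0 < box_weight o -> box_code o != set0.
Proof. by apply: contraTneq => o0; rewrite /box_weight o0 cards0 mul0r ltxx. Qed.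

Lemma sum_card_box_code (P : pred word) :
  \sum_o #|[set w in box_code o | P w]|%:R = boxes_per_word%:R * #|[set w in C | P w]|%:R :> R.
Proof.
rewrite -natr_sum -natrM; congr (_%:R); under eq_bigr do rewrite -sum1_card.
rewrite (exchange_big_dep (mem [set w in C | P w])) /= => [|o w _]; last first.
  by rewrite !inE => /andP[/andP[-> _] ->].
rewrite mulnC -sum_nat_const; apply: eq_bigr => w; rewrite inE => /andP[wC Pw].
rewrite sum1_card -(card_boxes_of w); apply: eq_card => o.
by rewrite [RHS]inE -[LHS]/(w \in [set v in box_code o | P v]) !inE wC Pw andbT.
Qed.

Lemma sum_box_weight : \sum_o box_weight o = 1.
Proof.
rewrite -mulr_suml; have -> : \sum_o #|box_code o|%:R = boxes_per_word%:R * #|C|%:R :> R.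
  have setT_of (D : {set word}) : [set w in D | predT w] = D.
    by apply/setP => w; rewrite inE andbT.
  by have := sum_card_box_code predT; rewrite setT_of; under eq_bigr do rewrite setT_of.
by rewrite [boxes_per_word%:R * _]mulrC mulfV // mulf_neq0 ?gt_eqF.
Qed.

Lemma mean_box_symlaw i a : \sum_o box_weight o * symlaw R (box_code o) i a = symlaw R C i a.
Proof.
transitivity (\sum_o symcount R (box_code o) i a / (#|C|%:R * boxes_per_word%:R)).
  apply: eq_bigr => o _; have [box0|box_neq0] := eqVneq (box_code o) set0.
    rewrite /box_weight box0 cards0 !mul0r /symcount (_ : #|_| = 0%N) ?mul0r //.
    by apply: eq_card0 => w; rewrite !inE.
  by rewrite /box_weight (symcountE _ _ _ box_neq0) [RHS]mulrAC.
rewrite -mulr_suml /symcount (sum_card_box_code (fun w => tnth w i == a)) /symlaw /symcount.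
by field; rewrite !gt_eqF.
Qed.

Lemma distinct_box_average_le i : free_condition R b m -> window_condition R b m ->
  \sum_o box_weight o * distinct m (symlaw R (box_code o) i) (symlaw R C i) <=
  (if (i < l)%N then window_factor R b else 1) * distinct_uniform R b m.
Proof.
move=> free_ok window_ok; have mean a := mean_box_symlaw i a; case: ifP => il; last first.
  rewrite mul1r -[X in distinct_uniform R X m]card_ord.
  apply: (distinct_mixture_free_le m_gt0 _ box_weight_ge0 sum_box_weight mean) => [||o];
    rewrite ?card_ord //.
  by move=> /box_code_neq0 o0; apply: law_symlaw.
rewrite -[X in distinct_uniform R X m]card_ord -[X in window_factor R X]card_ord.
apply: (distinct_mixture_window_le (S := fun o => window (o i)) m_gt0 _ box_weight_ge0
    sum_box_weight mean) => [||o|o]; rewrite ?card_ord //; last exact: card_window.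
move=> /box_code_neq0 o0.
apply: law_symlaw => // w; rewrite inE => /andP[_ /forallP/(_ i)].
by rewrite il.
Qed.

Lemma hansel_box o : hash_code m.+3 C ->
  (box_weight o - m.+1%:R ^+ 2 / (#|C|%:R * boxes_per_word%:R))
    * trimmed_ln R m.+1 #|C| <=
  ln (b - m.+1)%:R * m.+1`!%:R
    * \sum_i box_weight o * distinct m (symlaw R (box_code o) i) (symlaw R C i).
Proof.
move=> hC; have [box0|box_neq0] := eqVneq (box_code o) set0.
  rewrite big1 => [|i _]; last by rewrite /box_weight box0 cards0 !mul0r.
  rewrite /box_weight box0 cards0 mul0r sub0r mulr0 mulNr oppr_le0.
  by rewrite mulr_ge0 ?trimmed_ln_ge0 // divr_ge0 ?mulr_ge0.
have box_gt0 : 0 < #|box_code o|%:R :> R by rewrite ltr0n card_gt0.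
have -> : box_weight o - m.+1%:R ^+ 2 / (#|C|%:R * boxes_per_word%:R) =
    box_weight o * (1 - m.+1%:R ^+ 2 / #|box_code o|%:R).
  by rewrite /box_weight; field; rewrite !gt_eqF.
rewrite -mulr_sumr [leRHS]mulrCA -[leLHS]mulrA; apply: ler_wpM2l; first exact: box_weight_ge0.
by apply: hansel_subcode => //; apply/subsetP => w; rewrite inE => /andP[].
Qed.

Lemma sum_prefix_const (z : R) :
  \sum_(i < n) (if (i < l)%N then z else 1) = n%:R - (1 - z) * l%:R.
Proof.
rewrite (big_ord_ifltn _ _ _ le_ln) /= !sumr_const !card_ord -[1 *+ _]/(_%:R) natrB //.
by rewrite -mulr_natr; ring.
Qed.

Lemma hash_code_ln_le : hash_code m.+3 C -> free_condition R b m -> window_condition R b m ->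
  (1 - m.+1%:R ^+ 2 * (b%:R / m.+1%:R) ^+ l / #|C|%:R)
    * trimmed_ln R m.+1 #|C| <=
  full_rate R b m * (n%:R - (1 - window_factor R b) * l%:R).
Proof.
move=> hC free_ok window_ok.
have lossE : \sum_(o : {ffun 'I_n -> 'I_b}) m.+1%:R ^+ 2 / (#|C|%:R * boxes_per_word%:R) =
    m.+1%:R ^+ 2 * (b%:R / m.+1%:R) ^+ l / #|C|%:R :> R.
  rewrite sumr_const card_ffun !card_ord -[LHS]mulr_natr /boxes_per_word.
  rewrite -[X in (b ^ X)%:R](subnKC le_ln) expnD !natrM !natrX expr_div_n.
  by field; rewrite !lt0r_neq0 ?exprn_gt0.
rewrite -lossE -[X in X - _]sum_box_weight -sumrB mulr_suml.
apply: le_trans (ler_sum _ (fun o _ => hansel_box o hC)) _.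
have -> : full_rate R b m = ln (b - m.+1)%:R * m.+1`!%:R * distinct_uniform R b m.
  by rewrite /full_rate -mulrA; congr (_ * _); rewrite mulrC divfK // pnatr_eq0 -lt0n fact_gt0.
rewrite -mulr_sumr exchange_big -sum_prefix_const -mulrA.
rewrite ler_wpM2l ?mulr_ge0 ?ln_natr_ge0 // mulr_sumr; apply: ler_sum => i _.
by rewrite [leRHS]mulrC distinct_box_average_le.
Qed.

End Boxes.

(** * Growth of [A_hash] *)

Definition prefix_rate (R : realType) (b m : nat) (theta : R) : R :=
  full_rate R b m * (1 - (1 - window_factor R b) * theta).

Lemma A_hash_attained b k n :
  exists C : {set n.-tuple 'I_b}, hash_code k.+1 C /\ #|C| = A_hash b k.+1 n.
Proof.
have hash0 : hash_code k.+1 (set0 : {set n.-tuple 'I_b}).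
  by move=> S; rewrite subset0 => /eqP ->; rewrite cards0.
have [|C hC CE] := @eq_bigmax_cond _
  [pred C : {set n.-tuple 'I_b} | `[< hash_code k.+1 C >]] (fun C => #|C|).
  by apply/card_gt0P; exists set0; apply/asboolP.
by exists C; split; [exact/asboolP|rewrite -CE].
Qed.

Section Growth.
Variables (R : realType) (b' m : nat).
Local Notation b := b'.+1.
Hypotheses (m_gt0 : (0 < m)%N) (mb : (m.+1 < b)%N).
Hypotheses (free_ok : free_condition R b m) (window_ok : window_condition R b m).
Variables theta M : R.
Hypotheses (theta_ge0 : 0 <= theta) (theta_le1 : theta <= 1) (M_ge0 : 0 <= M).
Local Notation decay := (expR (theta * ln (b%:R / m.+1%:R) - M)).
Local Notation prefix_length n := (Num.truncn (theta * n%:R)).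

Let factorC_ge0 : 0 <= 1 - window_factor R b.
Proof.
have b3 : 3 <= b%:R :> R by rewrite ler_nat (leq_trans _ mb).
by rewrite subr_ge0 ler_pdivrMr ?mul1r; lra.
Qed.

Lemma full_rate_ge0 : 0 <= full_rate R b m.
Proof. by rewrite mulr_ge0 ?ln_natr_ge0 ?birthday_ge0. Qed.

Lemma hash_code_ln_le_prefix n (C : {set n.-tuple 'I_b}) : hash_code m.+3 C -> C != set0 ->
  (1 - m.+1%:R ^+ 2 * (b%:R / m.+1%:R) ^+ prefix_length n / #|C|%:R)
    * trimmed_ln R m.+1 #|C| <=
  n%:R * prefix_rate b m theta + full_rate R b m * (1 - window_factor R b).
Proof.
move=> hC C0; have /andP[l_le l_gt] := truncn_itv (mulr_ge0 theta_ge0 (ler0n R n)).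
have le_ln : (prefix_length n <= n)%N by rewrite -(ler_nat R) (le_trans l_le) // ler_piMl.
apply: le_trans (hash_code_ln_le m_gt0 mb le_ln C0 hC free_ok window_ok) _.
have -> : n%:R * prefix_rate b m theta + full_rate R b m * (1 - window_factor R b) =
    full_rate R b m * (n%:R - (1 - window_factor R b) * (theta * n%:R - 1)).
  by rewrite /prefix_rate; ring.
by rewrite ler_wpM2l ?full_rate_ge0 // lerB // ler_wpM2l // lerBlDr natr1 ltW.
Qed.

Lemma expr_prefix_length_le n x : 1 <= x -> x ^+ prefix_length n <= expR (theta * ln x) ^+ n.
Proof.
move=> x1; have /andP[l_le _] := truncn_itv (mulr_ge0 theta_ge0 (ler0n R n)).
rewrite -{1}[x]lnK ?posrE ?(lt_le_trans ltr01) // -!expRM_natl ler_expR.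
by rewrite mulrA [n%:R * theta]mulrC ler_wpM2r // ln_ge0.
Qed.

Lemma loss_le_decay n N : n%:R * M < ln N -> 0 < N ->
  m.+1%:R ^+ 2 * (b%:R / m.+1%:R) ^+ prefix_length n / N <= m.+1%:R ^+ 2 * decay ^+ n /\
  m.+1%:R / N <= m.+1%:R ^+ 2 * decay ^+ n.
Proof.
move=> N_large N0; set x := b%:R / m.+1%:R.
have x1 : 1 <= x by rewrite ler_pdivlMr // mul1r ler_nat ltnW.
have pow_le : expR (theta * ln x) ^+ n / N <= decay ^+ n.
  rewrite ler_pdivrMr // expRD exprMn -mulrA ler_peMr ?exprn_ge0 ?expR_ge0 //.
  rewrite -expRM_natl -ler_ln ?posrE ?mulr_gt0 ?expR_gt0 // ln1 lnM ?posrE ?expR_gt0 // expRK.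
  by rewrite mulrN addrC subr_ge0 ltW.
split.
  rewrite -mulrA ler_wpM2l ?sqr_ge0 //; apply: le_trans pow_le.
  by rewrite ler_pM2r ?invr_gt0 // expr_prefix_length_le.
apply: ler_pM => //; first by rewrite invr_ge0 ltW.
  by rewrite expr2 ler_peMr // ler1n.
apply: le_trans pow_le; rewrite -[leLHS]mul1r ler_pM2r ?invr_gt0 //.
by rewrite exprn_ege1 // -expR0 ler_expR mulr_ge0 // ln_ge0.
Qed.

Lemma ln_A_hash_le n :
  2 * m.+1%:R ^+ 2 * decay ^+ n < 1 ->
  n%:R * prefix_rate b m theta + full_rate R b m * (1 - window_factor R b) <
  (1 - 2 * m.+1%:R ^+ 2 * decay ^+ n) * (n%:R * M - ln 2) ->
  ln (A_hash b m.+3 n)%:R <= n%:R * M.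
Proof.
move=> decay_small; have [C [hC <-]] := A_hash_attained b m.+2 n.
apply: contraTT; rewrite -leNgt -ltNge => C_large.
have C0 : C != set0.
  by apply: contraTneq C_large => ->; rewrite cards0 ln0 // -leNgt mulr_ge0.
have N0 : 0 < #|C|%:R :> R by rewrite ltr0n card_gt0.
have [] := loss_le_decay C_large N0.
set loss := _ * _ ^+ _ / _; set q := decay ^+ n in decay_small *; set s := _ / _ => loss_le s_le.
have half : m.+1%:R <= #|C|%:R / 2 :> R by rewrite mulrC -ler_pdivrMr // -/s; lra.
have subE : (#|C| - m.+1)%:R = #|C|%:R - m.+1%:R :> R by rewrite natrB // -(ler_nat R); lra.
have ln_ge : n%:R * M - ln 2 <= ln (#|C| - m.+1)%:R.
  apply: (@le_trans _ _ (ln #|C|%:R - ln 2)); first by rewrite lerD2r ltW.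
  rewrite -ln_div ?posrE // ler_ln ?posrE ?divr_gt0 // subE; lra.
apply: le_trans (hash_code_ln_le_prefix hC C0); rewrite -/loss.
rewrite /trimmed_ln (_ : (#|C| - m.+1)%:R / #|C|%:R = 1 - s); last first.
  by rewrite subE mulrBl mulfV ?gt_eqF.
apply: (@le_trans _ _ ((1 - 2 * m.+1%:R ^+ 2 * q) * ln (#|C| - m.+1)%:R)).
  by apply: ler_wpM2l ln_ge; rewrite subr_ge0 ltW.
rewrite [leRHS]mulrA; apply: ler_wpM2r; first exact: ln_natr_ge0.
have loss_ge0 : 0 <= loss by rewrite !mulr_ge0 ?invr_ge0 ?exprn_ge0 // divr_ge0.
have s_ge0 : 0 <= s by rewrite divr_ge0.
nra.
Qed.

End Growth.

Lemma near_ln_A_hash_le (R : realType) (b m : nat) (theta M : R) :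
  (0 < m)%N -> (m.+1 < b)%N -> free_condition R b m -> window_condition R b m ->
  0 <= theta <= 1 -> theta * ln (b%:R / m.+1%:R) < M ->
  prefix_rate b m theta < M ->
  (\forall n \near \oo, ln (A_hash b m.+3 n)%:R <= n%:R * M)%classic.
Proof.
case: b => // b' m_gt0 mb free_ok window_ok /andP[theta_ge0 theta_le1] theta_M rate_M.
have M_ge0 : 0 <= M.
  apply: le_trans (ltW theta_M); rewrite mulr_ge0 // ln_ge0 // ler_pdivlMr //.
  by rewrite mul1r ler_nat ltnW.
pose q := expR (theta * ln (b'.+1%:R / m.+1%:R) - M).
have q01 : 0 <= q < 1 by rewrite expR_ge0 expR_lt1 subr_lt0.
have := near_infty_affine_lt (2 * m.+1%:R ^+ 2) (full_rate R b'.+1 m * (1 - window_factor R b'.+1))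
  (ln 2) q01 rate_M.
by apply: filterS => n []; exact: ln_A_hash_le.
Qed.

(* For M = (x1^-1 + c^-1)^-1 and theta = M / (r * x1) the second bound is an
   equality and the first one is strict, so theta can be increased slightly. *)
Lemma exists_rate_parameters (R : realFieldType) (c x1 x2 r : R) :
  0 < c -> 0 < x1 -> 0 < x2 -> x2 < r * x1 -> c < r * (c + x1) ->
  exists theta M, [/\ 0 <= theta <= 1, theta * x2 < M, c * (1 - r * theta) < M &
    M < (x1^-1 + c^-1)^-1].
Proof.
move=> c0 x10 x20 x21 cx1; have rx : 0 < r * x1 := lt_trans x20 x21.
have r0 : 0 < r by rewrite -(pmulr_lgt0 _ x10).
set B := (_ + _)^-1; have BE : B = c * x1 / (c + x1).
  by rewrite /B; field; rewrite !gt_eqF // addr_gt0 ?invr_gt0.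
have B0 : 0 < B by rewrite BE divr_gt0 ?mulr_gt0 ?addr_gt0.
have Brx : B < r * x1 by rewrite BE ltr_pdivrMr ?addr_gt0 //; nra.
pose u := B / (r * x1); pose v := Num.min 1 (B / x2).
have uv : u < v.
  by rewrite lt_min ltr_pdivrMr // mul1r Brx ltr_pM2l // ltf_pV2 ?posrE.
have u0 : 0 < u by rewrite divr_gt0.
have [v1 vB] : v <= 1 /\ v <= B / x2 by rewrite !ge_min !lexx orbT.
pose theta := (u + v) / 2.
have [u_theta theta_v] : u < theta /\ theta < v by rewrite /theta; split; lra.
have thetaB : theta * x2 < B by rewrite -ltr_pdivlMr // (lt_le_trans theta_v).
have rateB : c * (1 - r * theta) < B.
  have -> : B = c * (1 - r * u) by rewrite /u BE; field; rewrite !gt_eqF ?addr_gt0.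
  by rewrite ltr_pM2l // ltrD2l ltrN2 ltr_pM2l.
exists theta, ((Num.max (theta * x2) (c * (1 - r * theta)) + B) / 2).
have [] : theta * x2 <= Num.max (theta * x2) (c * (1 - r * theta)) /\
  c * (1 - r * theta) <= Num.max (theta * x2) (c * (1 - r * theta)).
  by rewrite !le_max !lexx orbT.
have : Num.max (theta * x2) (c * (1 - r * theta)) < B by rewrite gt_max thetaB.
by split; lra.
Qed.

Section RateBound.
Variables (R : realType) (b m : nat).
Hypotheses (m_gt1 : (1 < m)%N) (kb : (m.+2 < b)%N).

Let mb : (m.+1 < b)%N. Proof. exact: ltnW. Qed.
Let b_gt0 : 0 < b%:R :> R. Proof. by rewrite ltr0n (leq_trans _ mb). Qed.
Let m_gt0 : 0 < m%:R :> R. Proof. by rewrite ltr0n ltnW. Qed.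
Let b1_gt0 : 0 < b%:R - 1 :> R. Proof. by rewrite subr_gt0 ltr1n (leq_trans _ mb). Qed.

Lemma full_rate_gt0 : 0 < full_rate R b m.
Proof.
apply: mulr_gt0; last by rewrite birthday_gt0 // (leq_trans _ mb).
by rewrite ln_gt0 // ltr1n ltn_subRL addn1.
Qed.

Lemma birthday_lt_ln : birthday R b m.+2 < ln (b%:R / m%:R).
Proof.
have ge_ln : 1 - m%:R / b%:R <= ln (b%:R / m%:R) :> R.
  by rewrite -[b%:R / m%:R]invf_div lnV ?posrE ?divr_gt0 // lerNr opprB ln_le_subr1 // divr_gt0.
have m1_gt0 : 0 < m.+1%:R / b%:R :> R by rewrite divr_gt0.
have mb_lt1 : m%:R / b%:R < 1 :> R by rewrite ltr_pdivrMr // mul1r ltr_nat ltnW // ltnW.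
apply: lt_le_trans ge_ln; rewrite !birthdayS.
have b0 : (0 < b)%N by rewrite (leq_trans _ mb).
have s_gt0 : 0 < 1 - m%:R / b%:R :> R by rewrite subr_gt0.
apply: (@lt_le_trans _ _ (birthday R b m * (1 - m%:R / b%:R))); last first.
  by rewrite ler_piMl ?birthday_le1 // ltW.
by rewrite gtr_pMr ?mulr_gt0 ?birthday_gt0 ?(ltnW (ltnW mb)) // gtrBl.
Qed.

Lemma full_rate_lt :
  full_rate R b m < (1 - window_factor R b) * (full_rate R b m + ln (b%:R / m%:R)).
Proof.
have birthday_pos : 0 < birthday R b m.+2 by rewrite birthday_gt0 // (leq_trans _ mb).
have b3 : (3 < b)%N by rewrite (leq_trans _ mb).
have bm_gt0 : 0 < (b - m.+1)%:R :> R by rewrite ltr0n subn_gt0.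
have twice : 2 * full_rate R b m < (b%:R - 3) * ln (b%:R / m%:R).
  apply: (@le_lt_trans _ _ ((b%:R - 3) * birthday R b m.+2)); last first.
    by rewrite ltr_pM2l ?birthday_lt_ln // subr_gt0 ltr_nat.
  rewrite /full_rate mulrA ler_pM2r // -ler_pdivlMl // mulrC.
  apply: le_trans (ln_le_half bm_gt0) _; rewrite ler_pM2r ?invr_gt0 //.
  by rewrite -natrB ?ler_nat ?leq_sub2l // ltnW.
rewrite -subr_gt0 /window_factor.
have -> : (1 - 2 / (b%:R - 1)) * (full_rate R b m + ln (b%:R / m%:R)) - full_rate R b m =
  ((b%:R - 3) * ln (b%:R / m%:R) - 2 * full_rate R b m) / (b%:R - 1).
  by field; rewrite gt_eqF.
by rewrite divr_gt0 // subr_gt0.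
Qed.

Lemma ln_window_lt : (b ^ 2 * m ^ (b - 3) < m.+1 ^ (b - 1))%N ->
  ln (b%:R / m.+1%:R) < (1 - window_factor R b) * ln (b%:R / m%:R).
Proof.
move=> lt_pow; have m0 : (0 < m)%N := ltnW m_gt1.
have b0 : (0 < b)%N by rewrite (leq_trans _ mb).
have : ln (b ^ 2 * m ^ (b - 3))%:R < ln (m.+1 ^ (b - 1))%:R :> R.
  by rewrite ltr_ln ?posrE ?ltr_nat // ltr0n ?muln_gt0 ?expn_gt0 ?b0 ?m0.
rewrite natrM lnM ?posrE ?ltr0n ?expn_gt0 ?b0 ?m0 // !ln_expn //.
rewrite !natrB ?(leq_trans _ mb) // => lt_ln.
rewrite !ln_div ?posrE // -subr_gt0 /window_factor.
have -> : (1 - 2 / (b%:R - 1)) * (ln b%:R - ln m%:R) - (ln b%:R - ln m.+1%:R) =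
  ((b%:R - 1) * ln m.+1%:R - (2 * ln b%:R + (b%:R - 3) * ln m%:R)) / (b%:R - 1) :> R.
  by field; rewrite gt_eqF.
by rewrite divr_gt0 // subr_gt0.
Qed.

Lemma hash_boundE :
  hash_bound b m.+3 = ((ln (b%:R / m%:R))^-1 + (full_rate R b m)^-1)^-1 / ln 2 :> R.
Proof.
have ln2_gt0 : 0 < ln 2 :> R by rewrite ln_gt0 // ltr1n.
have x1_gt0 : 0 < ln (b%:R / m%:R) :> R.
  by rewrite ln_gt0 // ltr_pdivlMr // mul1r ltr_nat ltnW // ltnW.
have -> : hash_bound b m.+3 = (1 / (ln (b%:R / m%:R) / ln 2) + (b ^ m.+2)%:R /
    ((b ^_ m.+2)%:R * (ln (b - m.+1)%:R / ln 2)))^-1 :> R.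
  have -> : (b - m.+1 = b - m.+3 + 2)%N by rewrite addnC addnBA // -[m.+3]/(2 + m.+1)%N subnDl.
  by rewrite /hash_bound /log2 !subSS !subn0.
have ffact_pos : 0 < (b ^_ m.+2)%:R :> R by rewrite ltr0n ffact_gt0 ltnW.
have expn_pos : 0 < (b ^ m.+2)%:R :> R by rewrite natrX exprn_gt0.
have ln_pos : 0 < ln (b - m.+1)%:R :> R by rewrite ln_gt0 // ltr1n ltn_subRL addn1.
rewrite /full_rate birthdayE -?(ltr0n R) //.
by field; rewrite !gt_eqF ?addr_gt0 ?mulr_gt0.
Qed.

Lemma R_hash_lt : free_condition R b m -> window_condition R b m ->
  (b ^ 2 * m ^ (b - 3) < m.+1 ^ (b - 1))%N ->
  (@R_hash R b m.+3 < (hash_bound b m.+3)%:E)%E.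
Proof.
move=> free_ok window_ok lt_pow; have ln2_gt0 : 0 < ln 2 :> R by rewrite ln_gt0 // ltr1n.
have ln_ratio_gt0 n : (0 < n)%N -> (n < b)%N -> 0 < ln (b%:R / n%:R) :> R.
  by move=> n0 nb; rewrite ln_gt0 // ltr_pdivlMr ?ltr0n // mul1r ltr_nat.
have [theta [M [theta01 theta_M rate_M M_lt]]] :=
  exists_rate_parameters full_rate_gt0 (ln_ratio_gt0 m (ltnW m_gt1) (ltnW mb))
    (ln_ratio_gt0 m.+1 isT mb) (ln_window_lt lt_pow) full_rate_lt.
apply: (@Order.POrderTheory.le_lt_trans _ _ (M / ln 2)%:E); last first.
  by rewrite lte_fin hash_boundE ltr_pM2r ?invr_gt0.
apply: limn_esup_le_near; near=> n.
have n0 : 0 < n%:R :> R by rewrite ltr0n; near: n; exact: nbhs_infty_gt.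
rewrite lee_fin /log2 ler_pdivrMr // mulrAC ler_pM2r ?invr_gt0 // [M * _]mulrC.
near: n; exact: near_ln_A_hash_le (ltnW m_gt1) mb free_ok window_ok theta01 theta_M rate_M.
Unshelve. all: by end_near. Qed.

End RateBound.

Ltac case_hash_pairs :=
  rewrite !inE; repeat (case/predU1P => [[-> ->]|]); last move=> /eqP[-> ->];
  rewrite !natn /subn /=.

Lemma hash_pairs_range b k : (b, k) \in hash_pairs ->
  [/\ k = (k - 3).+3, 1 < k - 3 & (k - 3).+2 < b]%N.
Proof. by case_hash_pairs. Qed.

Lemma hash_pairs_free_condition (R : realType) b k : (b, k) \in hash_pairs ->
  free_condition R b (k - 3).
Proof. by rewrite /free_condition /penalty unlock; case_hash_pairs; lra. Qed.

Lemma hash_pairs_window_condition (R : realType) b k : (b, k) \in hash_pairs ->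
  window_condition R b (k - 3).
Proof. by rewrite /window_condition /birthday_ratio unlock; case_hash_pairs; lra. Qed.

Lemma hash_pairs_power_lt b k : (b, k) \in hash_pairs ->
  (b ^ 2 * (k - 3) ^ (b - 3) < (k - 3).+1 ^ (b - 1))%N.
Proof. by case_hash_pairs; lia. Qed.

Theorem mainTheorem15 (R : realType) (b k : nat) :
  (b, k) \in hash_pairs ->
  (@R_hash R b k < (hash_bound b k)%:E)%E.
Proof.
move=> bk; have [kE m_gt1 kb] := hash_pairs_range bk; rewrite kE; apply: R_hash_lt => //.
- exact: hash_pairs_free_condition.
- exact: hash_pairs_window_condition.
- exact: hash_pairs_power_lt.
Qed.
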